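(* Let $f:\mathbb{R}^d\to\mathbb{R}$ be twice differentiable, strongly convex with parameter $\mu>0$, with gradient Lipschitz continuous with parameter $L>0$ (so $\mu\|x-y\|\le\|\nabla f(x)-\nabla f(y)\|\le L\|x-y\|$ for all $x,y\in\mathbb{R}^d$). Let $x_*$ be its unique minimizer, and suppose that for some constant $M\ge 0$, $\|\nabla^2 f(x)-\nabla^2 f(x_* )\|\le M\|x-x_*\|$ for all $x\in\mathbb{R}^d$. Consider the DFP and BFGS methods (see context) with initial point $x_0$ and symmetric positive-definite initial Hessian approximation $B_0$. Suppose that for DFP $$\frac{M}{\mu^{3/2}}\|\nabla^{2}f(x_* )^\frac{1}{2}(x_0 - x_* )\| \leq \frac{1}{120}, \qquad \|\nabla^{2}f(x_* )^{-\frac{1}{2}} (B_0 - \nabla^{2}f(x_* ))\nabla^{2}f(x_* )^{-\frac{1}{2}}\|_F \leq \frac{1}{7},$$ and that for BFGS $$\frac{M}{\mu^{3/2}}\|\nabla^{2}f(x_* )^\frac{1}{2}(x_0 - x_* )\| \leq \frac{1}{50}, \qquad \|\nabla^{2}f(x_* )^{-\frac{1}{2}} (B_0 - \nabla^{2}f(x_* ))\nabla^{2}f(x_* )^{-\frac{1}{2}}\|_F \leq \frac{1}{7}.$$ Then the iterates $\{x_k\}_{k\ge0}$ generated by the DFP method, respectively the BFGS method, satisfy for all $k\ge1$ $$\frac{\|\nabla^2 f(x_* )^{\frac{1}{2}}(x_k - x_* )\|}{\|\nabla^2 f(x_* )^{\frac{1}{2}}(x_0 - x_* )\|} \leq \left(\frac{1}{k}\right)^{\frac{k}{2}},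 \qquad \frac{f(x_k) - f(x_* )}{f(x_0) - f(x_* )} \leq 1.1\left(\frac{1}{k}\right)^{k}.$$
   Context: DFP and BFGS methods (unit step size): given $x_0\in\mathbb{R}^d$ and a symmetric positive-definite $B_0\in\mathbb{R}^{d\times d}$, for $k=0,1,2,\dots$ set $x_{k+1}=x_k-B_k^{-1}\nabla f(x_k)$, $s_k=x_{k+1}-x_k$, $y_k=\nabla f(x_{k+1})-\nabla f(x_k)$, and $B_{k+1}=B^{DFP}_{k+1}$ (DFP method) or $B_{k+1}=B^{BFGS}_{k+1}$ (BFGS method), where $$B^{DFP}_{k+1} = \left(I-\frac{y_k s_k^\top}{y_k^\top s_k}\right) B_k \left(I-\frac{ s_ky_k^\top}{s_k^\top y_k}\right) +\frac{y_k y_k^\top}{y_k^\top s_k},\qquad B^{BFGS}_{k+1} = B_k - \frac{B_k s_k s_k^\top B_k}{s_k^\top B_k s_k} + \frac{y_k y_k^\top}{s_k^\top y_k}.$$ The algorithm terminates if $s_k=0$ (in which case $x_k=x_*$); it is assumed throughout that $s_k\ne0$ for all $k$. Then $s_k^\top y_k>0$ and all $B_k$ are symmetric positive-definite. $\|\cdot\|$ is the Euclidean norm of vectors and the induced 2-norm of matrices, $\|\cdot\|_F$ is the Frobenius norm, and $A^{1/2},A^{-1/2}$ denote the symmetric positive-definite square roots of $A$ and $A^{-1}$. *)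

(* Defs.v *)
From mathcomp Require Import all_boot all_order all_algebra.
From mathcomp Require Import all_classical all_reals all_analysis.
Set Implicit Arguments.
Unset Strict Implicit.
Unset Printing Implicit Defensive.
Import Order.TTheory GRing.Theory Num.Theory.
Import numFieldNormedType.Exports.
Local Open Scope classical_set_scope.
Local Open Scope ring_scope.

Section LinearAlgebra.
Variables (R : realType) (d : nat).
Implicit Types (u v : 'cV[R]_d) (A : 'M[R]_d).

Definition dotv u v : R := (u^T *m v) 0 0.

(* The library norm `| v | on matrices is the max norm, so the Euclidean,
   induced and Frobenius norms are separate functions. *)
Definition enorm v : R := Num.sqrt (dotv v v).

Definition opnorm A : R :=
  sup [set enorm (A *m v) | v in [set v : 'cV[R]_d | enorm v <= 1]].

Definition frobenius_norm A : R := Num.sqrt (\sum_i \sum_j A i j ^+ 2).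

Definition sym_posdef A : Prop :=
  A^T = A /\ forall v, v != 0 -> 0 < dotv v (A *m v).

(* A symmetric positive-definite A has exactly one such root; the default 0
   is only reached when A is not symmetric positive-definite. *)
Definition mxsqrt A : 'M[R]_d := xget 0 [set S | sym_posdef S /\ S *m S = A].

End LinearAlgebra.

Section Calculus.
Variables (R : realType) (d : nat).
Implicit Types (f : 'cV[R]_d -> R) (x y : 'cV[R]_d).

Definition grad f x : 'cV[R]_d := \col_i 'D_(delta_mx i 0) f x.

Definition hess f x : 'M[R]_d :=
  \matrix_(i, j) 'D_(delta_mx j 0) (fun y => grad f y i 0) x.

(* Frechet differentiability; it does not depend on the choice of norm. *)
Definition twice_differentiable f : Prop :=
  (forall x, differentiable f x) /\ (forall x, differentiable (grad f) x).

Definition strongly_convex (mu : R) f : Prop :=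
  forall x y (t : R), 0 <= t <= 1 ->
    f (t *: x + (1 - t) *: y) <=
      t * f x + (1 - t) * f y - mu / 2 * t * (1 - t) * enorm (x - y) ^+ 2.

End Calculus.

Section QuasiNewton.
Variables (R : realType) (d : nat).
Implicit Types (B : 'M[R]_d) (s y x : 'cV[R]_d).

Definition dfp_update B s y : 'M[R]_d :=
  (1%:M - (dotv y s)^-1 *: (y *m s^T)) *m B
    *m (1%:M - (dotv s y)^-1 *: (s *m y^T))
  + (dotv y s)^-1 *: (y *m y^T).

Definition bfgs_update B s y : 'M[R]_d :=
  B - (dotv s (B *m s))^-1 *: (B *m s *m s^T *m B)
  + (dotv s y)^-1 *: (y *m y^T).

Variables (update : 'M[R]_d -> 'cV[R]_d -> 'cV[R]_d -> 'M[R]_d)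
  (f : 'cV[R]_d -> R) (x0 : 'cV[R]_d) (B0 : 'M[R]_d).

Definition qn_step (xB : 'cV[R]_d * 'M[R]_d) : 'cV[R]_d * 'M[R]_d :=
  let: (x, B) := xB in
  let x' := x - invmx B *m grad f x in
  (x', update B (x' - x) (grad f x' - grad f x)).

(* The pair (x_k, B_k). *)
Definition qn_state (k : nat) : 'cV[R]_d * 'M[R]_d := iter k qn_step (x0, B0).

Definition qn_iterate (k : nat) : 'cV[R]_d := (qn_state k).1.

Definition qn_nonterminating : Prop :=
  forall k, qn_iterate k.+1 - qn_iterate k != 0.

End QuasiNewton.

(* Main.v *)
Require Import Defs.
From mathcomp Require Import all_boot all_order all_algebra.
From mathcomp Require Import all_classical all_reals all_analysis.
From mathcomp Require Import ring lra complex.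
Set Implicit Arguments.
Unset Strict Implicit.
Unset Printing Implicit Defensive.
Import Order.TTheory GRing.Theory Num.Theory.
Import numFieldNormedType.Exports.
Local Open Scope ring_scope.

(** Put [H = hess f xs] and [T = H^(-1/2)]. In the coordinates
    [z = T^-1 (x - xs)], with gradients [g = T (grad f x)] and matrices
    [T B T], the Hessian at the minimizer is the identity and both updates
    keep their form. The Lipschitz bound on the Hessian becomes
    [|g - z| <= m |z|^2] and [|y - s| <= m max(|z|, |z'|) |s|], with
    [m = M / mu^(3/2)]: an iteration perturbs the quadratic model by a
    relative amount [sigma = m |z|].

    Let [E = T B T - 1] and [theta = |E s| / |s|], and suppose that
    [|E| <= 2 / 7] in Frobenius norm. When [y = s] exactly, either update lowers
    [|E|^2] by at least [theta^2 / 2]; the true [y] costs [|E|] at most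
    [kappa sigma] more ([bounded_deterioration], with [kappa = 15/2] for DFP and
    [25/8] for BFGS). The step equation [B s = - grad f x] reads
    [z' = - E s + (z - g)], so the ratio [r = |z'| / |z|] satisfies
    [r <= theta (1 + r) + sigma] ([quasi_newton_step]).

    These two facts feed each other. As long as [|E|] is small, [r <= 1/2];
    hence [sigma] decays geometrically, and the accumulated perturbations
    never let [|E|] leave a small ball. At the same time [r^2] is bounded by
    the decrease of a potential made of [|E|^2] and [sigma]
    ([potential_decrease]), whose initial value is at most [1]. So the squares
    of the ratios sum to at most [1], and the inequality of arithmetic and
    geometric means bounds the product of the first [k] of them by
    [(1 / k)^k] ([prod_ratio_AGM], [dev_superlinear]). The bound on [f] follows
    because [f x - f xs] is [|z|^2 / 2] up to a relative error [2 sigma]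
    ([value_near_quadratic]).

    Symmetry of [H] comes from second differences and [H >= mu] from strong
    convexity, each time using the Lipschitz bound at [xs] as a second order
    Taylor estimate; the square roots exist by the real spectral theorem. *)

(** * Frobenius inner product *)

Section FrobeniusInnerProduct.
Variable R : rcfType.

(** Column vectors are the case [n = 1], so that vectors, rank-one matrices
    and square matrices share one inner product. *)
Definition fdot m n (A B : 'M[R]_(m, n)) : R := \tr (A^T *m B).
Definition fnorm m n (A : 'M[R]_(m, n)) : R := Num.sqrt (fdot A A).

Lemma fdotE m n (A B : 'M[R]_(m, n)) : fdot A B = \sum_i \sum_j A i j * B i j.
Proof.
rewrite exchange_big; apply: eq_bigr => j _ /=.
by rewrite !mxE; apply: eq_bigr => i _; rewrite !mxE.
Qed.

Section FixedSize.
Variables m n : nat.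
Implicit Types A B C : 'M[R]_(m, n).

Lemma fdotC A B : fdot A B = fdot B A.
Proof. by rewrite /fdot -mxtrace_tr trmx_mul trmxK. Qed.

Lemma fdotDr A B C : fdot A (B + C) = fdot A B + fdot A C.
Proof. by rewrite /fdot mulmxDr raddfD. Qed.

Lemma fdotZr a A B : fdot A (a *: B) = a * fdot A B.
Proof. by rewrite /fdot -scalemxAr mxtraceZ. Qed.

Lemma fdotNr A B : fdot A (- B) = - fdot A B.
Proof. by rewrite -scaleN1r fdotZr mulN1r. Qed.

Lemma fdotDl A B C : fdot (A + B) C = fdot A C + fdot B C.
Proof. by rewrite fdotC fdotDr !(fdotC C). Qed.

Lemma fdotZl a A B : fdot (a *: A) B = a * fdot A B.
Proof. by rewrite fdotC fdotZr fdotC. Qed.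

Lemma fdotNl A B : fdot (- A) B = - fdot A B.
Proof. by rewrite fdotC fdotNr fdotC. Qed.

Definition fdot_lin := (fdotDl, fdotDr, fdotNl, fdotNr, fdotZl, fdotZr).

Lemma fdot_ge0 A : 0 <= fdot A A.
Proof.
by rewrite fdotE; do 2!apply: sumr_ge0 => ? _; rewrite -expr2 sqr_ge0.
Qed.

Lemma fdot_eq0 A : (fdot A A == 0) = (A == 0).
Proof.
apply/eqP/eqP => [|->]; last by rewrite -[0](scale0r 0) fdotZl mul0r.
move/eqP; rewrite fdotE psumr_eq0; last first.
  by move=> i _; apply: sumr_ge0 => j _; rewrite -expr2 sqr_ge0.
move=> /allP Ai0; apply/matrixP => i j; rewrite mxE.
have := Ai0 i (mem_index_enum _); rewrite psumr_eq0; last first.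
  by move=> ? _; rewrite -expr2 sqr_ge0.
by move=> /allP /(_ j (mem_index_enum _)); rewrite -expr2 sqrf_eq0 => /eqP.
Qed.

Lemma fdot_gt0 A : A != 0 -> 0 < fdot A A.
Proof. by rewrite lt0r fdot_eq0 fdot_ge0 andbT. Qed.

Lemma fnorm_ge0 A : 0 <= fnorm A.
Proof. exact: sqrtr_ge0. Qed.

Lemma sqr_fnorm A : fnorm A ^+ 2 = fdot A A.
Proof. by rewrite sqr_sqrtr ?fdot_ge0. Qed.

Lemma fnorm_eq0 A : (fnorm A == 0) = (A == 0).
Proof. by rewrite -fdot_eq0 -sqr_fnorm sqrf_eq0. Qed.

Lemma fnorm_gt0 A : (0 < fnorm A) = (A != 0).
Proof. by rewrite lt0r fnorm_eq0 fnorm_ge0 andbT. Qed.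

Lemma fnormN A : fnorm (- A) = fnorm A.
Proof. by rewrite /fnorm fdotNl fdotNr opprK. Qed.

Lemma fnormZ a A : fnorm (a *: A) = `|a| * fnorm A.
Proof.
by rewrite /fnorm fdotZl fdotZr mulrA -expr2 sqrtrM ?sqr_ge0// sqrtr_sqr.
Qed.

Lemma cauchy_schwarz_sqr A B : fdot A B ^+ 2 <= fdot A A * fdot B B.
Proof.
have [->|B0] := eqVneq B 0.
  by rewrite -[0](scale0r 0) !fdotZr !mul0r expr0n mulr0.
have bb := fdot_gt0 B0.
have := fdot_ge0 (fdot B B *: A - fdot A B *: B).
rewrite !fdot_lin (fdotC B A).
set a := fdot A A; set b := fdot B B in bb *; set c := fdot A B.
rewrite [X in 0 <= X](_ : _ = b * (a * b - c ^+ 2)); last by ring.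
by rewrite pmulr_rge0// subr_ge0.
Qed.

Lemma cauchy_schwarz A B : `|fdot A B| <= fnorm A * fnorm B.
Proof.
rewrite -(@ler_pXn2r _ 2) ?nnegrE ?mulr_ge0 ?fnorm_ge0//.
by rewrite real_normK ?num_real// exprMn !sqr_fnorm cauchy_schwarz_sqr.
Qed.

Lemma fdot_le_fnorm A B : fdot A B <= fnorm A * fnorm B.
Proof. exact: le_trans (ler_norm _) (cauchy_schwarz A B). Qed.

Lemma ler_fnormD A B : fnorm (A + B) <= fnorm A + fnorm B.
Proof.
rewrite -(@ler_pXn2r _ 2) ?nnegrE ?addr_ge0 ?fnorm_ge0//.
rewrite sqrrD !sqr_fnorm !fdot_lin (fdotC B A).
by have := fdot_le_fnorm A B; lra.
Qed.

Lemma ler_fnormB A B : fnorm (A - B) <= fnorm A + fnorm B.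
Proof. by rewrite -(fnormN B) ler_fnormD. Qed.

End FixedSize.

Lemma fdot_tr m n (A B : 'M[R]_(m, n)) : fdot A^T B^T = fdot A B.
Proof. by rewrite /fdot mxtrace_mulC -mxtrace_tr trmx_mul !trmxK. Qed.

Lemma fdot_mulmxl m n p (A : 'M[R]_(m, n)) (B : 'M[R]_(n, p)) C :
  fdot (A *m B) C = fdot B (A^T *m C).
Proof. by rewrite /fdot trmx_mul mulmxA. Qed.

Lemma fdot_mulmxr m n p (A : 'M[R]_(m, n)) (B : 'M[R]_(n, p)) C :
  fdot (A *m B) C = fdot A (C *m B^T).
Proof. by rewrite -fdot_tr trmx_mul fdot_mulmxl trmxK -fdot_tr trmx_mul !trmxK. Qed.

Lemma mulmx_tr11 n (u v : 'cV[R]_n) : u^T *m v = (fdot u v)%:M.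
Proof. by rewrite [LHS]mx11_scalar /fdot trace_mx11. Qed.

Lemma fdot_rank1l n (u v : 'cV[R]_n) (E : 'M[R]_n) :
  fdot (u *m v^T) E = fdot u (E *m v).
Proof. by rewrite fdot_mulmxr trmxK. Qed.

Lemma fdot_rank1r n (u v : 'cV[R]_n) (E : 'M[R]_n) :
  fdot E (u *m v^T) = fdot u (E *m v).
Proof. by rewrite fdotC fdot_rank1l. Qed.

Lemma mulmx_rank1 n (u v w : 'cV[R]_n) : u *m v^T *m w = fdot v w *: u.
Proof. by rewrite -mulmxA mulmx_tr11 mul_mx_scalar. Qed.

Lemma fnorm_rank1 n (u v : 'cV[R]_n) : fnorm (u *m v^T) = fnorm u * fnorm v.
Proof.
by rewrite /fnorm fdot_rank1l mulmx_rank1 fdotZr mulrC sqrtrM ?fdot_ge0.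
Qed.

Lemma fdot_sym n (A : 'M[R]_n) (u v : 'cV_n) : A^T = A ->
  fdot u (A *m v) = fdot (A *m u) v.
Proof. by move=> As; rewrite fdot_mulmxl As. Qed.

(** By Cauchy-Schwarz on each row of [A] against each column of [B]. *)
Lemma ler_fnormM m n p (A : 'M[R]_(m, n)) (B : 'M[R]_(n, p)) :
  fnorm (A *m B) <= fnorm A * fnorm B.
Proof.
rewrite -(@ler_pXn2r _ 2) ?nnegrE ?mulr_ge0 ?fnorm_ge0//.
rewrite exprMn !sqr_fnorm -(fdot_tr B B) !fdotE mulr_suml; apply: ler_sum => i _.
rewrite mulr_sumr; apply: ler_sum => j _; rewrite -expr2.
suff <- : fdot (row i A) (row j B^T) = (A *m B) i j.
  have := cauchy_schwarz_sqr (row i A) (row j B^T).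
  have rowE q r (M : 'M[R]_(q, r)) k :
    fdot (row k M) (row k M) = \sum_l M k l * M k l.
    by rewrite fdotE big_ord1; apply: eq_bigr => l _; rewrite !mxE.
  by rewrite !rowE.
by rewrite fdotE big_ord1 mxE; apply: eq_bigr => k _; rewrite !mxE.
Qed.

End FrobeniusInnerProduct.

Section EuclideanNorms.
Variables (R : realType) (d : nat).

Lemma dotvE (u v : 'cV[R]_d) : dotv u v = fdot u v.
Proof. by rewrite /dotv /fdot trace_mx11. Qed.

Lemma enormE (v : 'cV[R]_d) : enorm v = fnorm v.
Proof. by rewrite /enorm dotvE. Qed.

Lemma frobenius_normE (A : 'M[R]_d) : frobenius_norm A = fnorm A.
Proof.
by rewrite /frobenius_norm /fnorm fdotE; under eq_bigr do under eq_bigr do rewrite expr2.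
Qed.

End EuclideanNorms.

(** * Square roots of positive definite matrices *)

(** Over [R[i]] a symmetric real matrix is unitarily diagonalizable with a real
    diagonal; two real matrices that are similar over [R[i]] are similar over
    [R]. The basis so obtained is not orthogonal. *)
Lemma symmetric_diagonalizable (R : rcfType) n (A : 'M[R]_n) : A^T = A ->
  exists P (D : 'rV[R]_n), P \in unitmx /\ P *m A = diag_mx D *m P.
Proof.
move=> As; pose C : numClosedFieldType := complex.complex R.
pose io : {rmorphism R -> C} := complex.real_complex R.
have ioK m p (X : 'M[C]_(m, p)) : X \is a mxOver Num.real ->
    X = map_mx io (map_mx (@complex.Re R) X).
  move=> /mxOverP Xr; apply/matrixP => i j; rewrite !mxE.
  by rewrite /= complex.RRe_real.
pose AC := map_mx io A.
have ACr : AC \is a mxOver Num.real.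
  by apply/mxOverP => i j; rewrite mxE; apply/complex.complex_realP; exists (A i j).
have ACs : AC \is symmetricmx.
  by apply/is_hermitianmxP; rewrite expr0 scale1r map_mx_id// map_trmx As.
have ACh := realsym_hermsym ACs ACr.
have /hermitian_normalmx/orthomx_spectralP ACE := ACh.
have Dr := hermitian_spectral_diag_real ACh.
set Q := spectralmx AC in ACE; set sp := spectral_diag AC in ACE Dr.
have Qu : Q \in unitmx by exact: spectral_unit.
have Dr' : diag_mx sp \is a mxOver Num.real.
  apply/mxOverP => i j; rewrite mxE.
  have /mxOverP /(_ 0 i) := Dr.
  by case: (i == j) => /=; rewrite ?mulr1n ?mulr0n ?rpred0.
have [|P] := real_similar _ ACr Dr'.
  exists Q => //; apply/similarP => //.
  by rewrite [in LHS]ACE !mulmxA mulmxV// mul1mx.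
rewrite inE => /andP[Pr Pu] /(similarP Pu) PE.
exists (map_mx (@complex.Re R) P), (map_mx (@complex.Re R) sp).
split; first by rewrite -(map_unitmx io) -ioK.
apply: (@map_mx_inj _ _ io).
by rewrite !map_mxM map_diag_mx -!ioK.
Qed.

(** In an eigenbasis [P], the Gram matrix [P P^T] commutes with the diagonal
    matrix [D], hence with its entrywise square root; this is what makes
    [P^-1 D^(1/2) P] symmetric although [P] need not be orthogonal. *)
Lemma posdef_sqrt_ex (R : realType) n (A : 'M[R]_n) :
  sym_posdef A -> exists S, sym_posdef S /\ S *m S = A.
Proof.
move=> [As Ap]; have [P [D [Pu PA]]] := symmetric_diagonalizable As.
pose e i : 'cV[R]_n := delta_mx i 0.
have diagE (X : 'rV[R]_n) i : diag_mx X *m e i = X 0 i *: e i.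
  apply/matrixP => j k; rewrite !mxE (bigD1 j)//= big1 ?addr0 => [|l lj].
    rewrite !mxE eqxx mulr1n; case: eqVneq => [->|] //.
    by rewrite !mulr0.
  by rewrite !mxE eq_sym (negPf lj) mulr0n mul0r.
have AE i : A *m (invmx P *m e i) = D 0 i *: (invmx P *m e i).
  rewrite scalemxAr -diagE !mulmxA; congr (_ *m _).
  by apply: (canRL (mulKmx Pu)); rewrite mulmxA PA mulmxK.
have Pe i : invmx P *m e i != 0.
  apply/negP => /eqP /(congr1 (mulmx P)); rewrite mulmx0 mulKVmx// => ei0.
  by have /matrixP /(_ i 0) := ei0; rewrite !mxE !eqxx => /eqP; rewrite oner_eq0.
have D0 i : 0 < D 0 i.
  have := Ap _ (Pe i); rewrite AE dotvE fdotZr pmulr_lgt0//.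
  exact: fdot_gt0.
pose F phi := invmx P *m diag_mx (map_mx phi D) *m P.
have FF phi : F phi *m F phi = F (fun x => phi x ^+ 2).
  rewrite /F !mulmxA mulmxK// -[_ *m _ *m diag_mx _]mulmxA mulmx_diag.
  congr (_ *m diag_mx _ *m _); apply/rowP => j; by rewrite !mxE.
have eqF phi psi : (forall i, phi (D 0 i) = psi (D 0 i)) -> F phi = F psi.
  move=> e2; congr (_ *m diag_mx _ *m _); apply/rowP => j; by rewrite !mxE e2.
have F1 : F id = A by rewrite /F map_mx_id// -mulmxA -PA mulKmx.
pose G := P *m P^T.
have GD : G *m diag_mx D = diag_mx D *m G.
  rewrite /G mulmxA -PA -(tr_diag_mx D) -mulmxA -trmx_mul -PA trmx_mul As.
  by rewrite mulmxA.
have Fs phi : (F phi)^T = F phi.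
  have PTu : P^T \in unitmx by rewrite unitmx_tr.
  have GrD : G *m diag_mx (map_mx phi D) = diag_mx (map_mx phi D) *m G.
    apply/matrixP => i j; have /matrixP/(_ i j) := GD.
    rewrite !mul_mx_diag !mul_diag_mx !mxE => /eqP.
    rewrite mulrC -subr_eq0 -mulrBl mulf_eq0 => /orP[/eqP/subr0_eq->|/eqP->].
      by rewrite mulrC.
    by rewrite mulr0 mul0r.
  rewrite [RHS]/F -mulmxA; apply: (canRL (mulKmx Pu)).
  rewrite -[RHS]mulmx1 -(mulmxV PTu) mulmxA -[_ *m P *m _]mulmxA -/G -GrD.
  by rewrite /F !trmx_mul tr_diag_mx trmx_inv /G !mulmxA.
(* The fourth root [T] of [A] shows that [S = T ^ 2] is positive. *)
have SS : F Num.sqrt *m F Num.sqrt = A.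
  by rewrite FF -[RHS]F1; apply: eqF => i; rewrite sqr_sqrtr// ltW.
have TT : F (Num.sqrt \o Num.sqrt) *m F (Num.sqrt \o Num.sqrt) = F Num.sqrt.
  by rewrite FF; apply: eqF => i /=; rewrite sqr_sqrtr// sqrtr_ge0.
move: (F Num.sqrt) (F (_ \o _)) (Fs Num.sqrt) (Fs (Num.sqrt \o Num.sqrt)) SS TT.
move=> S T Ss Ts SS TT; exists S; split=> //; split=> // v v0.
rewrite dotvE -TT -mulmxA fdot_sym// fdot_gt0//.
apply/negP => /eqP Tv0; have := Ap v v0.
rewrite -SS -TT -!mulmxA Tv0 !mulmx0 dotvE.
by rewrite -[X in fdot _ X](scale0r v) fdotZr mul0r ltxx.
Qed.

Lemma mxsqrtP (R : realType) n (A : 'M[R]_n) : sym_posdef A ->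
  sym_posdef (mxsqrt A) /\ mxsqrt A *m mxsqrt A = A.
Proof.
by move=> /posdef_sqrt_ex; exact: xgetPex.
Qed.

Lemma sym_posdef_unit (R : realType) n (A : 'M[R]_n) :
  sym_posdef A -> A \in unitmx.
Proof.
move=> [As Ap]; rewrite -row_free_unit -kermx_eq0 -submx0; apply/rV_subP => u.
move=> /sub_kermxP uA0; rewrite submx0; apply/negPn/negP => u0.
have := Ap u^T; rewrite -(inj_eq (@trmx_inj _ _ _)) trmxK trmx0 => /(_ u0).
by rewrite /dotv trmxK mulmxA uA0 mul0mx mxE ltxx.
Qed.

Lemma sym_posdef_inv (R : realType) n (A : 'M[R]_n) :
  sym_posdef A -> sym_posdef (invmx A).
Proof.
move=> Aspd; have Au := sym_posdef_unit Aspd; have [As Ap] := Aspd.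
split=> [|v v0]; first by rewrite trmx_inv As.
have w0 : invmx A *m v != 0.
  by apply: contra_neq v0 => /(congr1 (mulmx A)); rewrite mulKVmx// mulmx0.
by have := Ap _ w0; rewrite mulKVmx// !dotvE fdotC.
Qed.

(** * Effect of one update on the distance to the identity *)

Section Updates.
Variables (R : realType) (d : nat).
Implicit Types (B E : 'M[R]_d) (s y u v : 'cV[R]_d).

Lemma rank1E u v i j : (u *m v^T) i j = u i 0 * v j 0.
Proof. by rewrite mxE big_ord1 mxE. Qed.

Lemma tr_rank1 u v : (u *m v^T)^T = v *m u^T.
Proof. by rewrite trmx_mul trmxK. Qed.

Lemma rank1Z c u v : (c *: u) *m (c *: v)^T = (c * c) *: (u *m v^T).
Proof. by apply/matrixP => i j; rewrite !(rank1E, mxE); ring. Qed.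

Lemma fdot_mulmx_le E v : `|fdot v (E *m v)| <= fnorm E * fdot v v.
Proof.
apply: le_trans (cauchy_schwarz _ _) _.
rewrite -sqr_fnorm expr2 mulrCA ler_wpM2l ?fnorm_ge0//.
exact: ler_fnormM.
Qed.

(** With [P] the projection orthogonal to [s], the matrix on the left is
    [P E P]: it loses the components of [E] along [s], whose squared norm is
    [2 |w|^2 - a^2]. *)
Lemma dfp_exact_decrease E s w (a := fdot s w) : E^T = E -> fdot s s = 1 ->
  E *m s = w ->
  fdot (E - s *m w^T - w *m s^T + a *: (s *m s^T))
       (E - s *m w^T - w *m s^T + a *: (s *m s^T)) <= fdot E E - fdot w w.
Proof.
move=> Es s1 Esw.
have sEw : fdot s (E *m w) = fdot w w by rewrite fdot_sym// Esw.
have aa : a ^+ 2 <= fdot w w.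
  by have := cauchy_schwarz_sqr s w; rewrite s1 mul1r.
have sw : fdot s w = a by [].
move: (a) sw aa => c sw aa.
rewrite !fdot_lin !fdot_rank1l !fdot_rank1r !mulmx_rank1 !fdot_lin.
rewrite Esw sEw (fdotC w s) sw s1; lra.
Qed.

(** The updates depend on [(s, y)] only up to a common factor, so [s] is
    normalized; [e] is then the relative error of the secant pair. *)
Section UnitStep.
Variables (s y : 'cV[R]_d) (e : R).
Hypotheses (s1 : fdot s s = 1) (e_le : e <= 1 / 50).
Hypothesis ys : fnorm (y - s) <= e.

Lemma fnorm_unit : fnorm s = 1.
Proof. by rewrite /fnorm s1 sqrtr1. Qed.

Lemma unit_step_e_ge0 : 0 <= e.
Proof. exact: le_trans (fnorm_ge0 _) ys. Qed.

Lemma secant_curvature_abs : `|fdot s (y - s)| <= e.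
Proof.
by apply: le_trans (cauchy_schwarz _ _) _; rewrite fnorm_unit mul1r.
Qed.

Lemma secant_curvatureE : fdot s y = 1 + fdot s (y - s).
Proof. by rewrite !fdot_lin s1; ring. Qed.

Lemma secant_curvature_ge : 1 - e <= fdot s y.
Proof.
rewrite secant_curvatureE lerD2l.
by have := secant_curvature_abs; rewrite ler_norml => /andP[].
Qed.

Lemma secant_curvature_gt0 : 0 < fdot s y.
Proof. by have := secant_curvature_ge; move: e_le; lra. Qed.

Lemma secant_curvature_inv : (fdot s y)^-1 <= 50 / 49.
Proof.
rewrite -div1r ler_pdivrMr ?secant_curvature_gt0//.
by have := secant_curvature_ge; move: e_le; lra.
Qed.

(** This is the price of replacing [s] by [y] in the rank-one term that both
    updates add. *)
Lemma rank1_perturbation :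
  fnorm ((fdot s y)^-1 *: (y *m y^T) - s *m s^T) <= 25 / 8 * e.
Proof.
set dl := y - s; have e0 := unit_step_e_ge0; have b0 := secant_curvature_gt0.
have -> : (fdot s y)^-1 *: (y *m y^T) - s *m s^T = (fdot s y)^-1 *:
  (dl *m s^T + s *m dl^T + dl *m dl^T - fdot s dl *: (s *m s^T)).
  apply: (@scalerI _ _ (fdot s y)); first by rewrite gt_eqF.
  rewrite scalerBr !scalerA divff ?gt_eqF// !scale1r secant_curvatureE.
  by apply/matrixP => i j; rewrite /dl !(rank1E, mxE); ring.
rewrite fnormZ ger0_norm ?invr_ge0 ?(ltW b0)//.
have bi := secant_curvature_inv.
have : fnorm (dl *m s^T + s *m dl^T + dl *m dl^T - fdot s dl *: (s *m s^T))
   <= e + e + e * e + e.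
  apply: le_trans (ler_fnormB _ _) (lerD _ _).
    apply: le_trans (ler_fnormD _ _) (lerD _ _).
      apply: le_trans (ler_fnormD _ _) (lerD _ _).
        by rewrite fnorm_rank1 fnorm_unit mulr1.
      by rewrite fnorm_rank1 fnorm_unit mul1r.
    by rewrite fnorm_rank1 ler_pM ?fnorm_ge0.
  by rewrite fnormZ fnorm_rank1 fnorm_unit !mulr1 secant_curvature_abs.
have : 0 <= (fdot s y)^-1 by rewrite invr_ge0 ltW.
move: (_ - _) => X bi0 hX.
have : (fdot s y)^-1 * fnorm X <= 50 / 49 * (e + e + e * e + e).
  by rewrite ler_pM ?fnorm_ge0.
have : e * e <= 1 / 50 * e by rewrite ler_wpM2r.
lra.
Qed.

(** The bound [2 / 7] leaves some room above [15 / 56], the value that the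
    distance never exceeds along the iteration. *)
Section SymmetricB.
Variable B : 'M[R]_d.
Hypotheses (Bs : B^T = B) (Ble : fnorm (B - 1%:M) <= 2 / 7).
Let E := B - 1%:M.
Let w := E *m s.

Lemma near1_le v : fdot v (B *m v) <= 9 / 7 * fdot v v.
Proof.
have -> : B = E + 1%:M by rewrite /E subrK.
rewrite mulmxDl mul1mx fdotDr.
have := fdot_mulmx_le E v; rewrite ler_norml => /andP[_].
have : fnorm E * fdot v v <= 2 / 7 * fdot v v by rewrite ler_wpM2r ?fdot_ge0.
lra.
Qed.

Lemma near1_ge v : 5 / 7 * fdot v v <= fdot v (B *m v).
Proof.
have -> : B = E + 1%:M by rewrite /E subrK.
rewrite mulmxDl mul1mx fdotDr.
have := fdot_mulmx_le E v; rewrite ler_norml => /andP[+ _].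
have : fnorm E * fdot v v <= 2 / 7 * fdot v v by rewrite ler_wpM2r ?fdot_ge0.
lra.
Qed.

(** Put [q = B s], [b = s . q], [n = |q|^2] and [t = q . B q]. The squared norm
    decreases by at least [(w . B w) / b = (t - 2 n + b) / b] as soon as
    [n^2 <= t b], which is Cauchy-Schwarz for the form [B]. The factor [1 / 2]
    is a lower bound for [(5 / 7) / (9 / 7)], the ratio of the extreme values
    of that form on unit vectors. *)
Lemma bfgs_exact_decrease :
  fdot (E - (fdot s (B *m s))^-1 *: ((B *m s) *m (B *m s)^T) + s *m s^T)
       (E - (fdot s (B *m s))^-1 *: ((B *m s) *m (B *m s)^T) + s *m s^T)
  <= fdot E E - 1 / 2 * fdot w w.
Proof.
set q := B *m s; set b := fdot s q.
have b0 : 5 / 7 <= b by have := near1_ge s; rewrite s1 mulr1.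
have b1 : b <= 9 / 7 by have := near1_le s; rewrite s1 mulr1.
have bp : 0 < b by lra.
have bn : b != 0 by rewrite gt_eqF.
set n := fdot q q; set t := fdot q (B *m q).
have wE : w = q - s by rewrite /w mulmxBl mul1mx.
have qs : fdot q s = b by rewrite fdotC.
have qEq : fdot q (E *m q) = t - n by rewrite mulmxBl mul1mx !fdot_lin.
have sEs : fdot s (E *m s) = b - 1 by rewrite mulmxBl mul1mx !fdot_lin s1.
have sBq : fdot s (B *m q) = n by rewrite fdot_sym.
have wBw : fdot w (B *m w) = t - 2 * n + b.
  rewrite wE mulmxBr !fdot_lin sBq -/q -/t -/b -/n; ring.
have tb : n ^+ 2 <= t * b.
  have := near1_ge (q - (n / b) *: s).
  have := fdot_ge0 (q - (n / b) *: s).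
  rewrite [X in _ -> _ <= X -> _](_ : _ = t - n ^+ 2 / b); last first.
    rewrite mulmxBr -scalemxAr !fdot_lin sBq -/q -/t -/b -/n.
    by field.
  move=> h1 h2; have : 0 <= t - n ^+ 2 / b by lra.
  by rewrite subr_ge0 ler_pdivrMr.
have hw : 1 / 2 * fdot w w <= (t - 2 * n + b) / b.
  rewrite ler_pdivlMr// -wBw; have := near1_ge w.
  have : 1 / 2 * fdot w w * b <= 1 / 2 * fdot w w * (9 / 7).
    by rewrite ler_wpM2l// mulr_ge0 ?fdot_ge0//; lra.
  have := fdot_ge0 w; lra.
(* [E] is a difference: without this the bilinearity rules would unfold it. *)
clearbody w E.
rewrite !fdot_lin !fdot_rank1l !fdot_rank1r !mulmx_rank1 !fdot_lin.
rewrite qEq sEs qs -/q -/b -/n s1.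
apply: le_trans (lerB (lexx (fdot E E)) hw).
rewrite -subr_ge0.
rewrite [X in 0 <= X](_ : _ = (t * b - n ^+ 2) / b ^+ 2); last by field.
by rewrite divr_ge0 ?sqr_ge0// subr_ge0.
Qed.

Lemma bfgs_unit_step : exists N, [/\ 0 <= N,
  fnorm (bfgs_update B s y - 1%:M) <= N + 25 / 8 * e &
  N ^+ 2 + 1 / 2 * fdot w w <= fdot E E].
Proof.
set X := E - (fdot s (B *m s))^-1 *: ((B *m s) *m (B *m s)^T) + s *m s^T.
exists (fnorm X); split; first exact: fnorm_ge0; last first.
  by rewrite sqr_fnorm; have := bfgs_exact_decrease; rewrite -/X; lra.
have -> : bfgs_update B s y - 1%:M =
    X + ((fdot s y)^-1 *: (y *m y^T) - s *m s^T).
  rewrite /bfgs_update !dotvE /X /E.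
  rewrite trmx_mul Bs !mulmxA.
  by apply/matrixP => i j; rewrite !(rank1E, mxE); ring.
by apply: le_trans (ler_fnormD _ _) _; rewrite lerD2l rank1_perturbation.
Qed.

Let a := fdot s w.

(** Compared with the exact pair, the factor [1 - s s^T] becomes
    [1 - s s^T + u s^T] with [u = s - y / (s . y)] of size [O(e)]. All the new
    terms contain [u], and the ones linear in [u] meet
    [(1 - s s^T) B s = w - a s], which is small too. *)

Lemma dfp_unit_step : exists N, [/\ 0 <= N,
  fnorm (dfp_update B s y - 1%:M) <= N + 15 / 2 * e &
  N ^+ 2 + 1 / 2 * fdot w w <= fdot E E].
Proof.
have e0 := unit_step_e_ge0.
set X := E - s *m w^T - w *m s^T + a *: (s *m s^T).
exists (fnorm X); split; first exact: fnorm_ge0; last first.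
  have Es : E^T = E by rewrite /E linearB/= Bs trmx1.
  have := dfp_exact_decrease Es s1 (erefl w); have := fdot_ge0 w.
  by rewrite sqr_fnorm -/X; lra.
pose b := fdot s y; pose u := s - b^-1 *: y; pose p := w - a *: s.
have wE : w = B *m s - s by rewrite /w mulmxBl mul1mx.
have -> : dfp_update B s y - 1%:M = X
  + (u *m p^T + p *m u^T + (1 + a) *: (u *m u^T))
  + (b^-1 *: (y *m y^T) - s *m s^T).
  pose v := u - s; pose q := B *m s.
  have sBs : s^T *m q = (1 + a)%:M.
    rewrite mulmx_tr11 /q -[B](subrK 1%:M) mulmxDl mul1mx fdotDr s1 addrC.
    by rewrite -/E -/w.
  have -> : dfp_update B s y = B + v *m q^T + q *m v^T + (1 + a) *: (v *m v^T)
      + b^-1 *: (y *m y^T).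
    rewrite /dfp_update !dotvE (fdotC y s) -/b.
    have -> : 1%:M - b^-1 *: (y *m s^T) = 1%:M + v *m s^T.
      by apply/matrixP => i j; rewrite /v /u !(rank1E, mxE); ring.
    have -> : 1%:M - b^-1 *: (s *m y^T) = 1%:M + s *m v^T.
      by apply/matrixP => i j; rewrite /v /u !(rank1E, mxE); ring.
    have qT : q^T = s^T *m B by rewrite trmx_mul Bs.
    rewrite mulmxDl mul1mx mulmxDr mulmx1 mulmxDl; congr (_ + _).
    rewrite -[v *m s^T *m B]mulmxA -qT !mulmxA -/q addrA; congr (_ + _).
    rewrite -[v *m q^T *m s]mulmxA mulmx_tr11 fdotC -mulmx_tr11 sBs.
    by rewrite mul_mx_scalar scalemxAl.
  have qE : q = s + w by rewrite wE addrC subrK.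
  rewrite qE /X /p /v.
  by apply/matrixP => i j; rewrite !(rank1E, mxE, big_ord1); ring.
have hw : fnorm w <= 2 / 7.
  by apply: le_trans (ler_fnormM _ _) _; rewrite fnorm_unit mulr1.
have ha : `|a| <= 2 / 7.
  by apply: le_trans (cauchy_schwarz _ _) _; rewrite fnorm_unit mul1r.
have hp : fnorm p <= 4 / 7.
  apply: le_trans (ler_fnormB _ _) _; rewrite fnormZ fnorm_unit mulr1; lra.
have hu : fnorm u <= 5 / 2 * e.
  have -> : u = b^-1 *: (fdot s (y - s) *: s - (y - s)).
    have bn : b != 0 by rewrite gt_eqF// secant_curvature_gt0.
    apply: (scalerI bn); rewrite /u scalerBr !scalerA divff// !scale1r.
    have -> : b = 1 + fdot s (y - s) by rewrite -secant_curvatureE.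
    by apply/matrixP => i j; rewrite !mxE; ring.
  have bi0 : 0 <= b^-1 by rewrite invr_ge0 ltW ?secant_curvature_gt0.
  rewrite fnormZ ger0_norm//.
  have : fnorm (fdot s (y - s) *: s - (y - s)) <= e + e.
    apply: le_trans (ler_fnormB _ _) (lerD _ _) => //.
    by rewrite fnormZ fnorm_unit mulr1 secant_curvature_abs.
  move=> h; apply: (@le_trans _ _ (50 / 49 * (e + e))); last by lra.
  by rewrite ler_pM ?fnorm_ge0 ?secant_curvature_inv.
rewrite -addrA; apply: le_trans (ler_fnormD _ _) _; rewrite lerD2l.
apply: le_trans (ler_fnormD _ _) _.
have := rank1_perturbation; rewrite -/b => h1.
have hup : fnorm u * fnorm p <= 5 / 2 * e * (4 / 7) by rewrite ler_pM ?fnorm_ge0.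
have huu : fnorm u * fnorm u <= 5 / 2 * e * (5 / 2 * e) by rewrite ler_pM ?fnorm_ge0.
have ha1 : `|1 + a| <= 9 / 7 by apply: le_trans (ler_normD _ _) _; rewrite normr1; lra.
have h2 : fnorm (u *m p^T + p *m u^T + (1 + a) *: (u *m u^T)) <=
   fnorm u * fnorm p + fnorm p * fnorm u + `|1 + a| * (fnorm u * fnorm u).
  apply: le_trans (ler_fnormD _ _) (lerD _ _); last by rewrite fnormZ fnorm_rank1.
  by apply: le_trans (ler_fnormD _ _) _; rewrite !fnorm_rank1.
have h3 : `|1 + a| * (fnorm u * fnorm u) <= 9 / 7 * (5 / 2 * e * (5 / 2 * e)).
  by rewrite ler_pM ?mulr_ge0 ?fnorm_ge0.
have : e * e <= 1 / 50 * e by rewrite ler_wpM2r.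
lra.
Qed.

End SymmetricB.
End UnitStep.

(** * Properties shared by the two updates *)

Variable update : 'M[R]_d -> 'cV[R]_d -> 'cV[R]_d -> 'M[R]_d.

(** [N] is the distance to the identity that the exact pair [y = s] would give;
    [kappa * e] pays for the inexact one. *)
Definition bounded_deterioration (kappa : R) : Prop := forall B s y e,
  B^T = B -> fnorm (B - 1%:M) <= 2 / 7 -> s != 0 -> e <= 1 / 50 ->
  fnorm (y - s) <= e * fnorm s ->
  exists N, [/\ 0 <= N, fnorm (update B s y - 1%:M) <= N + kappa * e &
    N ^+ 2 + 1 / 2 * (fnorm ((B - 1%:M) *m s) / fnorm s) ^+ 2
      <= fnorm (B - 1%:M) ^+ 2].

Definition scale_invariant : Prop := forall c B s y, c != 0 ->
  update B (c *: s) (c *: y) = update B s y.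

(** Steps and gradients transform contragrediently under a linear change of
    variables; [D] stands for the inverse of [C]. *)
Definition congruence_equivariant : Prop := forall C D B s y,
  C^T = C -> C *m D = 1%:M ->
  update (C *m B *m C) (D *m s) (C *m y) = C *m update B s y *m C.

Definition preserves_symmetry : Prop := forall B s y,
  B^T = B -> (update B s y)^T = update B s y.

Lemma bounded_deterioration_unit kappa : scale_invariant ->
  (forall B s y e, fdot s s = 1 -> e <= 1 / 50 -> fnorm (y - s) <= e ->
    B^T = B -> fnorm (B - 1%:M) <= 2 / 7 ->
    exists N, [/\ 0 <= N, fnorm (update B s y - 1%:M) <= N + kappa * e &
      N ^+ 2 + 1 / 2 * fdot ((B - 1%:M) *m s) ((B - 1%:M) *m s)
        <= fdot (B - 1%:M) (B - 1%:M)]) ->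
  bounded_deterioration kappa.
Proof.
move=> scale unit_step B s y e Bs Ble s0 e_le ys.
have ns : 0 < fnorm s by rewrite fnorm_gt0.
pose c := (fnorm s)^-1; have c0 : 0 < c by rewrite invr_gt0.
have cn : c != 0 by rewrite gt_eqF.
have s1 : fdot (c *: s) (c *: s) = 1.
  by rewrite !fdot_lin -sqr_fnorm expr2 mulKf ?mulVf ?gt_eqF.
have ys1 : fnorm (c *: y - c *: s) <= e.
  by rewrite -scalerBr fnormZ gtr0_norm// mulrC ler_pdivrMr.
have := unit_step B _ _ _ s1 e_le ys1 Bs Ble.
rewrite scale// -scalemxAr fdotZl fdotZr -!sqr_fnorm => -[N [N0 N1 N2]].
exists N; split=> //.
suff -> : (fnorm ((B - 1%:M) *m s) / fnorm s) ^+ 2 =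
  c * (c * fnorm ((B - 1%:M) *m s) ^+ 2) by [].
by rewrite exprMn -/c mulrC expr2 mulrA.
Qed.

End Updates.

Section TheTwoUpdates.
Variables (R : realType) (d : nat).

Lemma dfp_scale_invariant : scale_invariant (@dfp_update R d).
Proof.
move=> c B s y c0; rewrite /dfp_update !dotvE !fdot_lin.
have cc (a : R) : (c * (c * a))^-1 * (c * c) = a^-1.
  by rewrite mulrA invfM mulrAC mulVf ?mul1r// mulf_neq0.
by rewrite !rank1Z !scalerA !cc.
Qed.

Lemma bfgs_scale_invariant : scale_invariant (@bfgs_update R d).
Proof.
move=> c B s y c0; rewrite /bfgs_update !dotvE -!scalemxAr !fdot_lin.
have cc (a : R) : (c * (c * a))^-1 * (c * c) = a^-1.
  by rewrite mulrA invfM mulrAC mulVf ?mul1r// mulf_neq0.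
by rewrite !rank1Z -!scalemxAl !scalerA !cc.
Qed.

Lemma dfp_preserves_symmetry : preserves_symmetry (@dfp_update R d).
Proof.
move=> B s y Bs; rewrite /dfp_update !dotvE (fdotC s y).
have QT (u v : 'cV[R]_d) b : (1%:M - b *: (u *m v^T))^T = 1%:M - b *: (v *m u^T).
  by apply/matrixP => k l; rewrite !(rank1E, mxE) eq_sym mulrC; ring.
rewrite [LHS]linearD/= !trmx_mul !QT Bs mulmxA; congr (_ + _).
by apply/matrixP => k l; rewrite !(rank1E, mxE); ring.
Qed.

Lemma bfgs_preserves_symmetry : preserves_symmetry (@bfgs_update R d).
Proof.
move=> B s y Bs; rewrite /bfgs_update.
have -> : B *m s *m s^T *m B = (B *m s) *m (B *m s)^T.
  by rewrite trmx_mul Bs mulmxA.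
rewrite [LHS]linearD/= [X in X + _]linearB/= Bs; congr (_ - _ + _).
  by rewrite [LHS]linearZ/= tr_rank1.
by rewrite [LHS]linearZ/= tr_rank1.
Qed.

Lemma dfp_congruence : congruence_equivariant (@dfp_update R d).
Proof.
move=> C D B s y Cs CD; have DC : D *m C = 1%:M by rewrite mulmx1C.
have DsC : (D *m s)^T *m C = s^T.
  by rewrite trmx_mul -mulmxA -{1}Cs -trmx_mul CD trmx1 mulmx1.
have CDs : C *m (D *m s) = s by rewrite mulmxA CD mul1mx.
have sy : fdot (D *m s) (C *m y) = fdot s y.
  by rewrite fdot_sym// CDs.
rewrite /dfp_update !dotvE !(fdotC _ (D *m s)) sy (fdotC y s); set b := _^-1.
have e1 : (1%:M - b *: (C *m y *m (D *m s)^T)) *m C = C *m (1%:M - b *: (y *m s^T)).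
  rewrite mulmxBl mul1mx mulmxBr mulmx1 -scalemxAl -scalemxAr; congr (_ - _ *: _).
  by rewrite -!mulmxA DsC.
have e2 : C *m (1%:M - b *: (D *m s *m (C *m y)^T)) = (1%:M - b *: (s *m y^T)) *m C.
  rewrite mulmxBl mul1mx mulmxBr mulmx1 -scalemxAl -scalemxAr; congr (_ - _ *: _).
  by rewrite mulmxA CDs trmx_mul Cs mulmxA.
rewrite [X in _ = X *m _]mulmxDr [RHS]mulmxDl; congr (_ + _).
  move: (1%:M - _) (1%:M - _) (1%:M - _) (1%:M - _) e1 e2 => Q1 Q2 Q3 Q4 e1 e2.
  by rewrite !mulmxA e1 -!mulmxA e2.
by rewrite -scalemxAr -scalemxAl trmx_mul Cs !mulmxA.
Qed.

Lemma bfgs_congruence : congruence_equivariant (@bfgs_update R d).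
Proof.
move=> C D B s y Cs CD; have DC : D *m C = 1%:M by rewrite mulmx1C.
have DsC : (D *m s)^T *m C = s^T.
  by rewrite trmx_mul -mulmxA -{1}Cs -trmx_mul CD trmx1 mulmx1.
have CDs : C *m (D *m s) = s by rewrite mulmxA CD mul1mx.
have sy : fdot (D *m s) (C *m y) = fdot s y.
  by rewrite fdot_sym// CDs.
have CBs : C *m B *m C *m (D *m s) = C *m (B *m s) by rewrite -!mulmxA CDs.
have sBs : fdot (D *m s) (C *m (B *m s)) = fdot s (B *m s).
  by rewrite fdot_sym// CDs.
rewrite /bfgs_update !dotvE CBs sy sBs !mulmxDr mulmxN !mulmxDl mulNmx.
congr (_ - _ + _); rewrite -scalemxAr -scalemxAl; congr (_ *: _).
  rewrite -!mulmxA; congr (_ *m (_ *m (_ *m _))).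
  by rewrite !mulmxA DsC.
by rewrite trmx_mul Cs !mulmxA.
Qed.

Lemma dfp_bounded_deterioration : bounded_deterioration (@dfp_update R d) (15 / 2).
Proof.
apply: bounded_deterioration_unit dfp_scale_invariant _.
by move=> *; apply: dfp_unit_step.
Qed.

Lemma bfgs_bounded_deterioration : bounded_deterioration (@bfgs_update R d) (25 / 8).
Proof.
apply: bounded_deterioration_unit bfgs_scale_invariant _.
by move=> *; apply: bfgs_unit_step.
Qed.

End TheTwoUpdates.

(** * The scalar recursion *)

Section Recursion.
Variable R : realType.
Implicit Types eta theta sg kappa N z r : R.

(** Here [eta] is the distance of the matrix to the identity and [sg] the
    relative error of the quadratic model. The decrease of [9 * eta ^+ 2] pays
    for the squared ratio up to [9 * (15 / 28) * kappa * sg + 2 * sg ^+ 2];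
    since [sg] at least halves at each step, twice that amount, with
    [sg ^+ 2 <= sg / 50], is what the linear term has to provide. *)
Definition potential kappa eta sg : R :=
  9 * eta ^+ 2 + (135 / 14 * kappa + 2 / 25) * sg.

Lemma contraction_ratio eta theta sg r : eta <= 15 / 56 -> theta <= eta ->
  0 <= r -> sg <= 1 / 50 -> r <= theta * (1 + r) + sg ->
  r <= 1 / 2.
Proof.
move=> he ht hr hs h.
have : theta * (1 + r) <= 15 / 56 * (1 + r) by rewrite ler_wpM2r; lra.
lra.
Qed.

(** The quantity [eta + 2 * kappa * sg] does not increase, since the gain
    [kappa * sg] of [eta] is compensated by the halving of [sg]; [15 / 56] is
    [1 / 7 + 2 / 16], its largest initial value. *)
Lemma potential_decrease kappa eta theta sg r N eta' :
  0 <= kappa -> 0 <= theta -> 0 <= sg -> 0 <= r -> 0 <= N -> 0 <= eta' ->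
  theta <= eta -> sg <= 1 / 50 -> eta + 2 * kappa * sg <= 15 / 56 ->
  r <= theta * (1 + r) + sg -> eta' <= N + kappa * sg ->
  N ^+ 2 + 1 / 2 * theta ^+ 2 <= eta ^+ 2 ->
  eta' + 2 * kappa * (r * sg) <= 15 / 56 /\
  r ^+ 2 <= potential kappa eta sg - potential kappa eta' (r * sg).
Proof.
move=> k0 t0 s0 r0 N0 e'0 te s50 inv hr he' hN.
have ks0 : 0 <= kappa * sg by rewrite mulr_ge0.
have r2 : r <= 1 / 2 by apply: contraction_ratio te r0 s50 hr; lra.
have rs : r * sg <= 1 / 2 * sg by rewrite ler_wpM2r.
have krs : kappa * (r * sg) <= 1 / 2 * (kappa * sg).
  by rewrite mulrCA ler_wpM2r.
have Ne : N <= eta.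
  rewrite -(@ler_pXn2r _ 2) ?nnegrE//; last by lra.
  have := sqr_ge0 theta; lra.
have e'le : eta' <= 15 / 56 by lra.
split; first by lra.
have hN2 : eta' ^+ 2 - 2 * (kappa * sg) * eta' <= N ^+ 2.
  (* When [eta'] is below the perturbation, the left-hand side is nonpositive. *)
  have [h|h] := leP (kappa * sg) eta'.
    have : (eta' - kappa * sg) ^+ 2 <= N ^+ 2.
      by rewrite ler_pXn2r ?nnegrE//; lra.
    have := sqr_ge0 (kappa * sg); lra.
  have : eta' * eta' <= kappa * sg * eta' by rewrite ler_wpM2r// ltW.
  have : 0 <= kappa * sg * eta' by rewrite mulr_ge0.
  have := sqr_ge0 N; lra.
have ke' : kappa * sg * eta' <= kappa * sg * (15 / 56) by rewrite ler_wpM2l.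
have rt : r <= 3 / 2 * theta + sg.
  have : theta * r <= theta * (1 / 2) by rewrite ler_wpM2l.
  lra.
have r2t : r ^+ 2 <= 9 / 2 * theta ^+ 2 + 2 * sg ^+ 2.
  have : r ^+ 2 <= (3 / 2 * theta + sg) ^+ 2 by rewrite ler_pXn2r ?nnegrE//; lra.
  have := sqr_ge0 (3 / 2 * theta - sg); lra.
have ss : sg ^+ 2 <= 1 / 50 * sg by rewrite expr2 ler_wpM2r.
rewrite /potential; lra.
Qed.

Lemma prod_ratio_AGM (z : nat -> R) k : (forall i, 0 < z i) ->
  \sum_(i < k) (z i.+1 / z i) ^+ 2 <= 1 -> (0 < k)%N ->
  (z k / z 0%N) ^+ 2 <= (1 / k%:R) ^+ k.
Proof.
move=> z0 sum1 k0.
have -> : (z k / z 0%N) ^+ 2 = \prod_(i < k) (z i.+1 / z i) ^+ 2.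
  elim: {sum1} k k0 => [//|[|k] IH] _; first by rewrite big_ord1.
  rewrite big_ord_recr/= -IH// -exprMn; congr (_ ^+ 2).
  by rewrite mulrC -mulrA [RHS]mulrC; field; rewrite !gt_eqF.
have := @leif_AGM R 'I_k predT (fun i => (z i.+1 / z i) ^+ 2).
rewrite card_ord => -[|+ _]; first by move=> i _; exact: sqr_ge0.
move=> /le_trans; apply.
rewrite ler_pXn2r ?nnegrE ?divr_ge0 ?sumr_ge0 ?ler_pM2r ?invr_gt0 ?ltr0n// => i _;
  exact: sqr_ge0.
Qed.

End Recursion.

(** * Calculus along segments *)

Lemma ler_linear_error (R : realType) (a b K : R) :
  (forall t, 0 < t -> t <= 1 -> a <= b + K * t) -> a <= b.
Proof.
move=> H; apply/ler_addgt0Pr => e e0.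
have K1 : 0 < `|K| + 1 by rewrite ltr_wpDl.
pose t := Num.min 1 (e / (`|K| + 1)).
have t0 : 0 < t by rewrite lt_min ltr01 divr_gt0.
have t1 : t <= 1 by rewrite ge_min lexx.
apply: le_trans (H t t0 t1) _; rewrite lerD2l.
have te : t * (`|K| + 1) <= e by rewrite -ler_pdivlMr// ge_min lexx orbT.
have : K * t <= `|K| * t by rewrite ler_pM2r// ler_norm.
lra.
Qed.

Section Lines.
Variables (R : realType) (d : nat).
Implicit Types (f : 'cV[R]_d -> R) (x y u v w h : 'cV[R]_d) (A : 'M[R]_d).

Lemma cV_sum_delta v : v = \sum_i v i 0 *: delta_mx i 0.
Proof.
by rewrite [LHS]matrix_sum_delta; apply: eq_bigr => i _; rewrite big_ord1.
Qed.

Lemma derive_cV f x v : differentiable f x ->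
  'D_v f x = \sum_i 'D_(delta_mx i 0) f x * v i 0.
Proof.
move=> df; rewrite deriveE// {1}[v]cV_sum_delta linear_sum.
by apply: eq_bigr => i _; rewrite linearZ/= deriveE// mulrC.
Qed.

Lemma derive_grad f x v : differentiable f x -> 'D_v f x = fdot (grad f x) v.
Proof.
move=> df; rewrite derive_cV// fdotE; apply: eq_bigr => i _.
by rewrite big_ord1 mxE.
Qed.

Lemma differentiable_grad_coord f x i : differentiable (grad f) x ->
  differentiable (fun y => grad f y i 0) x.
Proof.
move=> dg; apply: (differentiable_comp (g := fun N : 'cV[R]_d => N i 0)) => //.
exact: differentiable_coord.
Qed.

Lemma derive_hess f x v i : differentiable (grad f) x ->
  'D_v (fun y => grad f y i 0) x = (hess f x *m v) i 0.
Proof.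
move=> dg; rewrite derive_cV; last exact: differentiable_grad_coord.
by rewrite [RHS]mxE; apply: eq_bigr => j _; rewrite !mxE.
Qed.

(** The two difference quotients coincide as functions of the increment. *)
Lemma is_derive_line f w v t : derivable f (w + t *: v) v ->
  is_derive (t : R) 1 (fun t => f (w + t *: v)) ('D_v f (w + t *: v)).
Proof.
have E : (fun h : R => h^-1 *: (((fun t => f (w + t *: v)) \o shift t) (h *: 1)
      - f (w + t *: v))) =
    (fun h : R => h^-1 *: ((f \o shift (w + t *: v)) (h *: v) - f (w + t *: v))).
  apply/funext => h /=; rewrite [h *: 1]mulr1 scalerDl.
  by rewrite addrCA.
by move=> df; split; rewrite /derivable /derive E.
Qed.

Lemma is_derive_grad_line f w v t : (forall x, differentiable f x) ->
  is_derive (t : R) 1 (fun t => f (w + t *: v)) (fdot (grad f (w + t *: v)) v).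
Proof.
move=> df; rewrite -derive_grad//; apply: is_derive_line.
exact: diff_derivable.
Qed.

Lemma is_derive_hess_line f u w v t : (forall x, differentiable (grad f) x) ->
  is_derive (t : R) 1 (fun t => fdot u (grad f (w + t *: v)))
    (fdot u (hess f (w + t *: v) *m v)).
Proof.
move=> dg.
have -> : (fun t => fdot u (grad f (w + t *: v))) =
    \sum_(i < d) (u i 0 \*: (fun t : R => grad f (w + t *: v) i 0)).
  apply/funext => r; rewrite fct_sumE fdotE; apply: eq_bigr => i _.
  by rewrite big_ord1.
rewrite fdotE; apply: is_derive_sum => i; rewrite big_ord1.
have di : is_derive t (1 : R) (fun t : R => grad f (w + t *: v) i 0)
    ((hess f (w + t *: v) *m v) i 0).
  rewrite -(derive_hess v i (dg (w + t *: v))).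
  apply: (@is_derive_line (fun y => grad f y i 0) w v t).
  exact/diff_derivable/differentiable_grad_coord.
exact: (is_deriveZ (u i 0) di).
Qed.

Lemma MVT01 (phi dphi : R -> R) : (forall t : R, is_derive t (1 : R) phi (dphi t)) ->
  exists2 c, 0 < c < 1 & phi 1 - phi 0 = dphi c.
Proof.
move=> dphiE.
have cphi : ({within `[0, 1], continuous phi})%classic.
  by apply: derivable_within_continuous => t _; have [] := dphiE t.
have [c] := MVT ltr01 (fun t _ => dphiE t) cphi.
by rewrite in_itv/= subr0 mulr1 => ? ?; exists c.
Qed.

(** The mean value theorem is applied to [f (x + r *: h) - r ^+ 2 * k / 2], whose
    derivative is the quantity bounded in the hypothesis: the factor [1 / 2]
    then appears without integrating the gradient. *)
Lemma mean_value_quadratic f x h k K : (forall x, differentiable f x) ->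
  (forall c, 0 < c -> c < 1 -> `|fdot (grad f (x + c *: h)) h - c * k| <= K) ->
  `|f (x + h) - f x - 1 / 2 * k| <= K.
Proof.
move=> df bound.
have dsq (r : R) : is_derive r (1 : R) (fun t : R => t * t) (r * 1 + r * 1).
  exact: (is_deriveM (is_derive_id r (1 : R)) (is_derive_id r (1 : R))).
have dphi (r : R) : is_derive r (1 : R)
    (fun t => f (x + t *: h) - k / 2 * (t * t))
    (fdot (grad f (x + r *: h)) h - k / 2 * (r * 1 + r * 1)).
  exact: (is_deriveB (is_derive_grad_line x h r df) (is_deriveZ (k / 2) (dsq r))).
have [c /andP[c0 c1]] := MVT01 dphi.
rewrite scale1r scale0r addr0 => E; have := bound c c0 c1.
rewrite (_ : _ - c * k = f (x + h) - f x - 1 / 2 * k)//; move: E; lra.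
Qed.

(** A vector-valued mean value theorem only gives inequalities: the scalar one
    is applied to the pairing of the gradient with the vector to be bounded. *)
Lemma grad_mean_value f A (P : 'M[R]_d) w h : (forall x, differentiable (grad f) x) ->
  exists2 c, 0 < c < 1 &
    fnorm (P *m (grad f (w + h) - grad f w - A *m h)) <=
    fnorm (P *m (hess f (w + c *: h) - A) *m h).
Proof.
move=> dg; set q := P *m _.
have [c c01] := MVT01 (fun t => is_derive_hess_line (P^T *m q) w h t dg).
rewrite scale1r scale0r addr0 => E; exists c => //.
have [->|q0] := eqVneq q 0.
  by rewrite -[0](scale0r 0) fnormZ normr0 mul0r fnorm_ge0.
have nq : 0 < fnorm q by rewrite fnorm_gt0.
rewrite -(ler_pM2l nq); apply: le_trans (fdot_le_fnorm _ _).
rewrite -expr2 sqr_fnorm le_eqVlt; apply/orP; left; apply/eqP.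
rewrite -mulmxA {2}/q -[P in RHS]trmxK -[P in LHS]trmxK -!fdot_mulmxl.
rewrite mulmxBl !fdot_lin -E; ring.
Qed.

End Lines.

(** * First and second order conditions at the minimizer *)

Section Minimizer.
Variables (R : realType) (d : nat) (f : 'cV[R]_d -> R) (xs : 'cV[R]_d).
Hypothesis df : forall x, differentiable f x.
Hypothesis xs_min : forall x, f xs <= f x.

Lemma grad_min : grad f xs = 0.
Proof.
apply/eqP; rewrite -fdot_eq0; apply/eqP; set v := grad f xs.
have D0 : is_derive (0 : R) 1 (fun t : R => f (xs + t *: v)) 0.
  apply: (@derive1_at_min R _ (-1) 1 0) => [|t _||t _]; first by lra.
  - exact: (@ex_derive _ _ _ _ _ _ _ (is_derive_grad_line xs v t df)).
  - by rewrite in_itv/=; apply/andP; split; lra.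
  - by rewrite scale0r addr0.
have [_ D1] := is_derive_grad_line xs v 0 df.
by move: D1; rewrite (@derive_val _ _ _ _ _ _ _ D0) scale0r addr0 => <-.
Qed.

(** Strong convexity between [x] and [xs], with a weight [t] on [x] that tends
    to [0], keeps the sharp constant [mu / 2]. *)
Lemma strongly_convex_growth mu x : strongly_convex mu f ->
  mu / 2 * fnorm (x - xs) ^+ 2 <= f x - f xs.
Proof.
move=> sc; set n := fnorm _ ^+ 2; have n0 : 0 <= n by exact: sqr_ge0.
apply: (@ler_linear_error _ _ _ (mu / 2 * n)) => t t0 t1.
have := sc x xs t; rewrite (ltW t0) t1 => /(_ isT).
rewrite enormE -/n => /(le_trans (xs_min _)) h.
rewrite -(ler_pM2l t0); lra.
Qed.

End Minimizer.

Section HessianAtMinimizer.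
Variables (R : realType) (d : nat) (f : 'cV[R]_d -> R) (xs : 'cV[R]_d).
Variables (mu M : R).
Hypothesis df : forall x, differentiable f x.
Hypothesis dg : forall x, differentiable (grad f) x.
Hypothesis xs_min : forall x, f xs <= f x.
Hypothesis M_ge0 : 0 <= M.
Hypothesis mu_gt0 : 0 < mu.
Hypothesis sc : strongly_convex mu f.
Variable H : 'M[R]_d.
Hypothesis hess_lip : forall (x v : 'cV[R]_d),
  fnorm ((hess f x - H) *m v) <= M * fnorm (x - xs) * fnorm v.

Lemma grad_taylor h : fnorm (grad f (xs + h) - H *m h) <= M * fnorm h ^+ 2.
Proof.
have [c /andP[c0 c1]] := grad_mean_value H 1%:M xs h dg.
rewrite (grad_min df xs_min) subr0 !mul1mx => /le_trans; apply.
apply: le_trans (hess_lip _ _) _.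
rewrite addrC addKr fnormZ gtr0_norm// expr2 [leRHS]mulrA ler_wpM2r ?fnorm_ge0//.
rewrite ler_wpM2l// ler_piMl ?fnorm_ge0//; exact: ltW.
Qed.

(** The second difference of [f] at [xs] is symmetric in the two increments;
    the mean value theorem evaluates it as [t ^+ 2 * fdot (H *m b) a] up to
    [O(t ^+ 3)]. *)
Lemma second_difference a b t : 0 < t ->
  `|(f (xs + t *: b + t *: a) - f (xs + t *: a) - f (xs + t *: b) + f xs)
     - t ^+ 2 * fdot (H *m b) a|
   <= 2 * M * (fnorm a + fnorm b) ^+ 3 * t ^+ 3.
Proof.
move=> t0; set S := fnorm a + fnorm b.
pose phi r := f (xs + t *: b + r *: (t *: a)) - f (xs + r *: (t *: a)).
have dphi r : is_derive r (1 : R) phi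
   (fdot (grad f (xs + t *: b + r *: (t *: a))) (t *: a)
    - fdot (grad f (xs + r *: (t *: a))) (t *: a)).
  exact: (is_deriveB (is_derive_grad_line _ _ _ df) (is_derive_grad_line _ _ _ df)).
have [c /andP[c0 c1]] := MVT01 dphi.
rewrite /phi !scale1r !scale0r !addr0.
set D := _ - _ - (_ - _) => E.
have -> : f (xs + t *: b + t *: a) - f (xs + t *: a) - f (xs + t *: b) + f xs = D.
  by rewrite /D; lra.
have cta : c *: (t *: a) = t *: (c *: a) by rewrite !scalerA mulrC.
rewrite E -[xs + _ + _]addrA cta.
set h1 := t *: b + _; set h2 := t *: (c *: a).
have n1 : fnorm h1 <= t * S.
  rewrite /h1 -scalerDr fnormZ gtr0_norm// ler_pM2l// addrC.
  apply: le_trans (ler_fnormD _ _) _; rewrite lerD2r fnormZ gtr0_norm//.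
  by rewrite ler_piMl ?fnorm_ge0// ltW.
have n2 : fnorm h2 <= t * S.
  rewrite /h2 fnormZ gtr0_norm// ler_pM2l// fnormZ gtr0_norm//.
  apply: (@le_trans _ _ (fnorm a)); last by rewrite lerDl fnorm_ge0.
  by rewrite ler_piMl ?fnorm_ge0// ltW.
set r1 := grad f (xs + h1) - H *m h1; set r2 := grad f (xs + h2) - H *m h2.
have -> : fdot (grad f (xs + h1)) (t *: a) - fdot (grad f (xs + h2)) (t *: a)
    - t ^+ 2 * fdot (H *m b) a = fdot (r1 - r2) (t *: a).
  have -> : grad f (xs + h1) = r1 + H *m h1 by rewrite subrK.
  have -> : grad f (xs + h2) = r2 + H *m h2 by rewrite subrK.
  rewrite /h1 mulmxDr -/h2 -[H *m (t *: b)]scalemxAr.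
  move: (H *m b) (H *m h2) r1 r2 => u v r1 r2.
  by rewrite !fdot_lin; ring.
apply: le_trans (cauchy_schwarz _ _) _.
have S0 : 0 <= S by rewrite addr_ge0 ?fnorm_ge0.
have bound h : fnorm h <= t * S -> fnorm (grad f (xs + h) - H *m h) <= M * (t * S) ^+ 2.
  move=> nh; apply: le_trans (grad_taylor h) _; rewrite ler_wpM2l//.
  by rewrite ler_pXn2r ?nnegrE ?fnorm_ge0 ?mulr_ge0// ltW.
have -> : 2 * M * S ^+ 3 * t ^+ 3 = 2 * (M * (t * S) ^+ 2) * (t * S) by ring.
apply: ler_pM; rewrite ?fnorm_ge0//.
  apply: le_trans (ler_fnormB _ _) _.
  have := bound _ n1; have := bound _ n2; rewrite -/r1 -/r2; lra.
by rewrite fnormZ gtr0_norm// ler_pM2l// lerDl fnorm_ge0.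
Qed.

Lemma hess_min_sym : H^T = H.
Proof.
have sym (a b : 'cV[R]_d) : fdot (H *m b) a <= fdot (H *m a) b.
  set K := M * (fnorm a + fnorm b) ^+ 3.
  apply: (@ler_linear_error _ _ _ (4 * K)) => t t0 t1.
  have := second_difference a b t0; have := second_difference b a t0.
  rewrite !ler_norml => /andP[_ h1] /andP[h2 _].
  move: h1; rewrite (addrC (fnorm b)) (addrAC xs) -[2 * M * _]mulrA -/K => h1.
  move: h2; rewrite -[2 * M * _]mulrA -/K => h2.
  have t2 : 0 < t ^+ 2 by rewrite exprn_gt0.
  rewrite -(ler_pM2l t2); lra.
have E i j (A : 'M[R]_d) :
    A i j = fdot (A *m (delta_mx j 0 : 'cV_d)) (delta_mx i 0).
  rewrite -colE fdotE (bigD1 i)//= big_ord1 !mxE !eqxx mulr1 big1 ?addr0// => k ki.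
  by rewrite big_ord1 !mxE (negPf ki) mulr0.
apply/matrixP => i j; rewrite mxE !E.
by apply/eqP; rewrite eq_le !sym.
Qed.

(** Quadratic growth of [f] along [v] is compared with its second order
    expansion, the increment tending to [0]. *)
Lemma hess_min_ge (v : 'cV[R]_d) : mu * fdot v v <= fdot v (H *m v).
Proof.
apply: (@ler_linear_error _ _ _ (2 * M * fnorm v ^+ 3)) => t t0 t1.
have := strongly_convex_growth xs_min (xs + t *: v) sc.
rewrite addrC addKr fnormZ gtr0_norm// exprMn sqr_fnorm => growth.
have upper : f (xs + t *: v) - f xs - 1 / 2 * (t ^+ 2 * fdot v (H *m v))
    <= M * t ^+ 3 * fnorm v ^+ 3.
  apply: le_trans (ler_norm _) _; apply: mean_value_quadratic => // c c0 c1.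
  have -> : grad f (xs + c *: (t *: v)) =
      (grad f (xs + c *: (t *: v)) - H *m (c *: (t *: v))) + H *m (c *: (t *: v)).
    by rewrite subrK.
  rewrite fdotDl -!scalemxAr !fdotZl [in X in _ + c * (t * X)]fdotZr.
  rewrite (fdotC (H *m v)) -addrA.
  rewrite [X in _ + X](_ : _ = 0) ?addr0; last by ring.
  apply: le_trans (cauchy_schwarz _ _) _.
  rewrite !scalemxAr.
  have -> : M * t ^+ 3 * fnorm v ^+ 3 = M * (t * fnorm v) ^+ 2 * (t * fnorm v).
    by ring.
  rewrite [fnorm (t *: v)]fnormZ gtr0_norm// ler_wpM2r ?mulr_ge0 ?fnorm_ge0 ?(ltW t0)//.
  apply: le_trans (grad_taylor _) _; rewrite ler_wpM2l//.
  rewrite ler_pXn2r ?nnegrE ?mulr_ge0 ?fnorm_ge0 ?(ltW t0)//.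
  rewrite !fnormZ !gtr0_norm// ler_piMl ?mulr_ge0 ?fnorm_ge0 ?(ltW t0)//.
  exact: ltW.
have t2 : 0 < t ^+ 2 by rewrite exprn_gt0.
rewrite -(ler_pM2l t2); lra.
Qed.

End HessianAtMinimizer.

(** * The problem in weighted coordinates *)

Section WeightedCoordinates.
Variables (R : realType) (d : nat) (f : 'cV[R]_d -> R) (xs : 'cV[R]_d).
Variables (mu M : R) (H T : 'M[R]_d).
Hypothesis df : forall x, differentiable f x.
Hypothesis dg : forall x, differentiable (grad f) x.
Hypothesis xs_min : forall x, f xs <= f x.
Hypothesis M_ge0 : 0 <= M.
Hypothesis mu_gt0 : 0 < mu.
Hypothesis H_ge : forall v : 'cV[R]_d, mu * fdot v v <= fdot v (H *m v).
Hypothesis hess_lip : forall (x v : 'cV[R]_d),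
  fnorm ((hess f x - H) *m v) <= M * fnorm (x - xs) * fnorm v.
Hypothesis T_sym : T^T = T.
Hypothesis TTH : T *m (T *m H) = 1%:M.

(** Since [T] is the inverse square root of [H], the matrix [T *m H] is the
    square root of [H]. *)
Definition dev x : 'cV[R]_d := T *m H *m (x - xs).
(** The Lipschitz constant [M / mu ^ (3/2)] of the Hessian in the weighted
    coordinates. *)
Definition scaled_lip : R := M / (mu * Num.sqrt mu).
Notation m := scaled_lip.

Lemma scaled_lip_ge0 : 0 <= m.
Proof. by rewrite divr_ge0// mulr_ge0 ?sqrtr_ge0// ltW. Qed.

Lemma mulTD (v : 'cV[R]_d) : T *m (T *m H *m v) = v.
Proof. by rewrite mulmxA TTH mul1mx. Qed.

Lemma devB x w : dev x - dev w = T *m H *m (x - w).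
Proof. by rewrite /dev -mulmxBr; congr (_ *m _); rewrite opprB addrA subrK. Qed.

(** The square of the left-hand side is the value at [u] of the quadratic form
    of the inverse of [H]. *)
Lemma fnorm_root_inv (u : 'cV[R]_d) : fnorm (T *m u) <= (Num.sqrt mu)^-1 * fnorm u.
Proof.
have smu : 0 < Num.sqrt mu by rewrite sqrtr_gt0.
pose v := T *m (T *m u).
have HTT : H *m (T *m T) = 1%:M by apply: mulmx1C; rewrite -mulmxA.
have Hv : H *m v = u by rewrite /v [T *m (T *m u)]mulmxA mulmxA HTT mul1mx.
have hv : mu * fnorm v <= fnorm u.
  have [->|v0] := eqVneq v 0.
    by rewrite -[0](scale0r 0) fnormZ normr0 mul0r mulr0 fnorm_ge0.
  have nv : 0 < fnorm v by rewrite fnorm_gt0.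
  rewrite -(ler_pM2l nv); apply: le_trans (fdot_le_fnorm _ _).
  by rewrite mulrCA -expr2 sqr_fnorm -Hv H_ge.
rewrite mulrC ler_pdivlMr// -(@ler_pXn2r _ 2) ?nnegrE ?mulr_ge0 ?fnorm_ge0 ?(ltW smu)//.
rewrite exprMn (sqr_sqrtr (ltW mu_gt0)) !sqr_fnorm.
have -> : fdot (T *m u) (T *m u) = fdot u v by rewrite fdot_mulmxl T_sym.
have := fdot_le_fnorm u v.
have : fnorm u * (mu * fnorm v) <= fnorm u * fnorm u by rewrite ler_wpM2l ?fnorm_ge0.
rewrite -[fnorm u * fnorm u]expr2 sqr_fnorm.
have := mu_gt0; move: (fdot u v) (fdot u u) => a b mu0 h1 h2.
have : a * mu <= fnorm u * fnorm v * mu by rewrite ler_pM2r.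
lra.
Qed.

(** In these coordinates [grad f] is close to the identity map. Three factors
    [mu ^ (-1/2)] appear: one for [T] on the outside, one for [x - w] and one
    for the distance to [xs] in the Lipschitz bound. *)
Lemma grad_near_linear x w r : fnorm (dev x) <= r -> fnorm (dev w) <= r ->
  fnorm (T *m (grad f x - grad f w) - (dev x - dev w))
    <= m * r * fnorm (dev x - dev w).
Proof.
move=> xr wr; have [c /andP[c0 c1]] := grad_mean_value H T w (x - w) dg.
rewrite [w + (x - w)]addrC subrK mulmxBr mulmxA -devB => /le_trans; apply.
set xc := w + _.
set al := (Num.sqrt mu)^-1; have al0 : 0 <= al by rewrite invr_ge0 sqrtr_ge0.
have devxc : fnorm (dev xc) <= r.
  have -> : dev xc = (1 - c) *: dev w + c *: dev x.
    rewrite /dev !scalemxAr -mulmxDr; congr (_ *m _).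
    by apply/matrixP => i j; rewrite !mxE; ring.
  apply: le_trans (ler_fnormD _ _) _; rewrite !fnormZ !gtr0_norm ?subr_gt0//.
  have : (1 - c) * fnorm (dev w) <= (1 - c) * r by rewrite ler_pM2l ?subr_gt0.
  have : c * fnorm (dev x) <= c * r by rewrite ler_pM2l.
  lra.
have nxc : fnorm (xc - xs) <= al * r.
  rewrite -[xc - xs]mulTD; apply: le_trans (fnorm_root_inv _) _.
  by rewrite ler_wpM2l.
have nxw : fnorm (x - w) <= al * fnorm (dev x - dev w).
  by rewrite -{1}[x - w]mulTD -devB fnorm_root_inv.
rewrite -mulmxA; apply: le_trans (fnorm_root_inv _) _; rewrite -/al.
have -> : m * r * fnorm (dev x - dev w) =
    al * (M * (al * r) * (al * fnorm (dev x - dev w))).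
  have -> : m = M * (al * al * al).
    rewrite /m /al -!invfM; congr (_ * _^-1).
    by rewrite -expr2 sqr_sqrtr// ltW.
  by ring.
rewrite ler_wpM2l//; apply: le_trans (hess_lip _ _) _.
have r0 : 0 <= r by apply: le_trans (fnorm_ge0 _) xr.
by rewrite ler_pM ?mulr_ge0 ?fnorm_ge0// ler_wpM2l.
Qed.

Lemma dev_min : dev xs = 0.
Proof. by rewrite /dev subrr mulmx0. Qed.

Lemma grad_near_dev x :
  fnorm (T *m grad f x - dev x) <= m * fnorm (dev x) * fnorm (dev x).
Proof.
have := @grad_near_linear x xs (fnorm (dev x)) (lexx _).
rewrite dev_min (grad_min df xs_min) !subr0; apply.
by rewrite -[0](scale0r 0) fnormZ normr0 mul0r fnorm_ge0.
Qed.

Lemma value_near_quadratic x :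
  `|f x - f xs - 1 / 2 * fnorm (dev x) ^+ 2|
    <= m * fnorm (dev x) * fnorm (dev x) ^+ 2.
Proof.
have := @mean_value_quadratic _ _ f xs (x - xs) (fnorm (dev x) ^+ 2)
  (m * fnorm (dev x) * fnorm (dev x) ^+ 2) df.
rewrite [xs + _]addrC subrK; apply => c c0 c1.
have devc : dev (xs + c *: (x - xs)) = c *: dev x.
  by rewrite /dev addrC addKr -scalemxAr.
have := grad_near_dev (xs + c *: (x - xs)); rewrite devc.
set g := grad f _; set z := dev x => gz.
have -> : fdot g (x - xs) = fdot (T *m g) z.
  by rewrite fdot_mulmxl T_sym mulTD.
have -> : fdot (T *m g) z - c * fnorm z ^+ 2 = fdot (T *m g - c *: z) z.
  by rewrite sqr_fnorm !fdot_lin.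
apply: le_trans (cauchy_schwarz _ _) _.
rewrite [_ ^+ 2]expr2 [leRHS]mulrA ler_wpM2r ?fnorm_ge0//.
apply: le_trans gz _; rewrite !fnormZ gtr0_norm//.
have cz : c * fnorm z <= fnorm z by rewrite ler_piMl ?fnorm_ge0 ?ltW.
have cz0 : 0 <= c * fnorm z by rewrite mulr_ge0 ?fnorm_ge0 ?ltW.
have mcz : m * (c * fnorm z) <= m * fnorm z by rewrite ler_wpM2l ?scaled_lip_ge0.
by apply: ler_pM => //; rewrite mulr_ge0 ?scaled_lip_ge0.
Qed.

Lemma dev_eq0 x : dev x = 0 -> x = xs.
Proof.
move=> dx; apply/eqP; rewrite -subr_eq0 -[x - xs]mulTD.
by rewrite -/(dev x) dx mulmx0.
Qed.

Section Step.
Variable update : 'M[R]_d -> 'cV[R]_d -> 'cV[R]_d -> 'M[R]_d.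
Variable kappa : R.
Hypothesis kappa_ge0 : 0 <= kappa.
Hypothesis update_bd : bounded_deterioration update kappa.
Hypothesis update_congr : congruence_equivariant update.
Hypothesis update_sym : preserves_symmetry update.

(** The error of [B] as an approximation of [H], in weighted coordinates. *)
Definition mxdev (B : 'M[R]_d) : 'M[R]_d := T *m B *m T - 1%:M.

Lemma near_hessian_unit B : B^T = B -> fnorm (mxdev B) <= 2 / 7 -> B \in unitmx.
Proof.
move=> Bs Ble; apply: sym_posdef_unit; split=> // u u0; rewrite dotvE.
pose v := T *m H *m u; have Tv : T *m v = u by rewrite mulTD.
have v0 : v != 0 by apply: contra_neq u0 => v0; rewrite -Tv v0 mulmx0.
have -> : fdot u (B *m u) = fdot v (T *m B *m T *m v).
  by rewrite -Tv -!mulmxA fdot_mulmxl T_sym.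
have TBs : (T *m B *m T)^T = T *m B *m T by rewrite !trmx_mul Bs T_sym mulmxA.
have := near1_ge Ble v; have := fdot_gt0 v0; lra.
Qed.

Lemma quasi_newton_step x B x' B' :
  qn_step update f (x, B) = (x', B') -> B^T = B -> x' - x != 0 ->
  m * fnorm (dev x) <= 1 / 50 ->
  fnorm (mxdev B) + 2 * kappa * (m * fnorm (dev x)) <= 15 / 56 ->
  [/\ B'^T = B', 0 < fnorm (dev x), fnorm (dev x') <= fnorm (dev x),
    fnorm (mxdev B') + 2 * kappa * (m * fnorm (dev x')) <= 15 / 56 &
    (fnorm (dev x') / fnorm (dev x)) ^+ 2 <=
      potential kappa (fnorm (mxdev B)) (m * fnorm (dev x)) -
      potential kappa (fnorm (mxdev B')) (m * fnorm (dev x'))].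
Proof.
move=> [x'E B'E] Bs s0 sg_le inv.
have sg0 : 0 <= m * fnorm (dev x) by rewrite mulr_ge0 ?scaled_lip_ge0 ?fnorm_ge0.
have ksg0 : 0 <= kappa * (m * fnorm (dev x)) by rewrite mulr_ge0.
have e27 : fnorm (mxdev B) <= 2 / 7 by lra.
have Bu := near_hessian_unit Bs e27.
set s := x' - x in s0 *; have BsE : B *m s = - grad f x.
  by rewrite /s -x'E addrAC subrr add0r mulmxN mulKVmx.
have z0 : 0 < fnorm (dev x).
  rewrite fnorm_gt0; apply: contra_neq s0 => /dev_eq0 xE.
  have : B *m s = 0 by rewrite BsE xE (grad_min df xs_min) oppr0.
  by move/(congr1 (mulmx (invmx B))); rewrite mulKmx// mulmx0.
pose sh := T *m H *m s; have Tsh : T *m sh = s by rewrite mulTD.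
have sh0 : sh != 0 by apply: contra_neq s0 => sh0; rewrite -Tsh sh0 mulmx0.
have nsh : 0 < fnorm sh by rewrite fnorm_gt0.
have shE : sh = dev x' - dev x by rewrite devB.
set z := fnorm (dev x) in z0 sg_le sg0 ksg0 inv *.
set z' := fnorm (dev x'); set sg := m * z in sg_le sg0 ksg0 inv *.
pose th := fnorm (mxdev B *m sh) / fnorm sh.
have th0 : 0 <= th by rewrite divr_ge0 ?fnorm_ge0.
have th_le : th <= fnorm (mxdev B) by rewrite ler_pdivrMr// ler_fnormM.
have Esh : mxdev B *m sh = - (T *m grad f x) - sh.
  by rewrite mulmxBl mul1mx -!mulmxA Tsh BsE mulmxN.
(* The new deviation consists of the error of [B] in the direction of the step
   and of the nonlinearity of the gradient. *)
have dev'E : dev x' = - (mxdev B *m sh) - (T *m grad f x - dev x).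
  by rewrite Esh shE; apply/matrixP => i j; rewrite !mxE; ring.
have z'_le : z' <= th * (z + z') + sg * z.
  rewrite /z' {1}dev'E; apply: le_trans (ler_fnormB _ _) _.
  rewrite fnormN lerD ?grad_near_dev//.
  rewrite -[fnorm (mxdev B *m sh)](divfK (lt0r_neq0 nsh)) ler_wpM2l//.
  by rewrite addrC shE ler_fnormB.
pose r := z' / z; have r0 : 0 <= r by rewrite divr_ge0 ?fnorm_ge0.
have rz : z' = r * z by rewrite divfK ?gt_eqF.
have r_le : r <= th * (1 + r) + sg.
  rewrite -(ler_pM2r z0) -rz; apply: le_trans z'_le _.
  by rewrite {1}rz; lra.
have e1556 : fnorm (mxdev B) <= 15 / 56 by lra.
have r2 := contraction_ratio e1556 th_le r0 sg_le r_le.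
have z'z : z' <= z by rewrite rz ler_piMl ?(ltW z0)//; lra.
pose y := grad f x' - grad f x.
have ysh : fnorm (T *m y - sh) <= sg * fnorm sh.
  by rewrite shE grad_near_linear.
have TBs : (T *m B *m T)^T = T *m B *m T by rewrite !trmx_mul Bs T_sym mulmxA.
have := update_bd TBs e27 sh0 sg_le ysh.
rewrite update_congr//.
have -> : update B s y = B' by rewrite -B'E x'E.
move=> [N [N0 hN1 hN2]].
have B's : B'^T = B' by rewrite -B'E update_sym.
have [] := potential_decrease kappa_ge0 th0 sg0 r0 N0 (fnorm_ge0 _) th_le sg_le
  inv r_le hN1 hN2.
have -> : r * sg = m * z' by rewrite rz /sg mulrCA.
by [].
Qed.

End Step.
End WeightedCoordinates.

(** * Operator norm and real powers *)

Section NormsAndPowers.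
Variable R : realType.

Lemma le_opnorm d (A : 'M[R]_d) (v : 'cV[R]_d) :
  fnorm (A *m v) <= opnorm A * fnorm v.
Proof.
have [->|v0] := eqVneq v 0.
  by rewrite mulmx0 -[0](scale0r 0) fnormZ normr0 !mul0r mulr0.
have nv : 0 < fnorm v by rewrite fnorm_gt0.
rewrite -ler_pdivrMr//; apply: ub_le_sup.
  exists (fnorm A) => _ [u /= u1 <-]; rewrite enormE in u1.
  rewrite enormE; apply: le_trans (ler_fnormM _ _) _.
  by rewrite ler_piMr ?fnorm_ge0.
exists ((fnorm v)^-1 *: v) => /=; rewrite enormE.
  by rewrite fnormZ gtr0_norm ?invr_gt0// mulVf ?gt_eqF.
by rewrite -scalemxAr fnormZ gtr0_norm ?invr_gt0// mulrC.
Qed.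

Lemma powR_three_halves (a : R) : 0 < a -> a `^ (3 / 2) = a * Num.sqrt a.
Proof.
move=> a0; have -> : 3 / 2 = 1 + 2^-1 :> R by lra.
by rewrite powRD ?gt_eqF ?implybT// powRr1 ?powR12_sqrt ?ltW.
Qed.

Lemma powR_half_nat (a : R) k : 0 <= a -> a `^ (k%:R / 2) = Num.sqrt (a ^+ k).
Proof. by move=> a0; rewrite powRrM powR_mulrn// powR12_sqrt ?exprn_ge0. Qed.

End NormsAndPowers.

(** * Superlinear convergence *)

Section Superlinear.
Variables (R : realType) (d : nat) (f : 'cV[R]_d -> R) (xs : 'cV[R]_d).
Variables (mu M : R) (H T : 'M[R]_d).
Hypothesis df : forall x, differentiable f x.
Hypothesis dg : forall x, differentiable (grad f) x.
Hypothesis xs_min : forall x, f xs <= f x.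
Hypothesis M_ge0 : 0 <= M.
Hypothesis mu_gt0 : 0 < mu.
Hypothesis H_ge : forall v : 'cV[R]_d, mu * fdot v v <= fdot v (H *m v).
Hypothesis hess_lip : forall (x v : 'cV[R]_d),
  fnorm ((hess f x - H) *m v) <= M * fnorm (x - xs) * fnorm v.
Hypothesis T_sym : T^T = T.
Hypothesis TTH : T *m (T *m H) = 1%:M.
Variable update : 'M[R]_d -> 'cV[R]_d -> 'cV[R]_d -> 'M[R]_d.
Variable kappa : R.
Hypothesis kappa_ge0 : 0 <= kappa.
Hypothesis update_bd : bounded_deterioration update kappa.
Hypothesis update_congr : congruence_equivariant update.
Hypothesis update_sym : preserves_symmetry update.
Variables (x0 : 'cV[R]_d) (B0 : 'M[R]_d).
Hypothesis B0_sym : B0^T = B0.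
Hypothesis nonterm : qn_nonterminating update f x0 B0.
Notation m := (scaled_lip mu M).
Notation z k := (fnorm (dev xs H T (qn_iterate update f x0 B0 k))).
Notation eta k := (fnorm (mxdev T (qn_state update f x0 B0 k).2)).
Hypothesis sigma0_le : m * z 0%N <= 1 / 50.
Hypothesis kappa_sigma0_le : kappa * (m * z 0%N) <= 1 / 16.
Hypothesis tau0_le : eta 0%N <= 1 / 7.

(** Each step preserves its own hypotheses, and its bound on the squared ratio
    telescopes. *)
Lemma qn_invariant k :
  [/\ (qn_state update f x0 B0 k).2^T = (qn_state update f x0 B0 k).2,
    m * z k <= 1 / 50, eta k + 2 * kappa * (m * z k) <= 15 / 56 &
    \sum_(i < k) (z i.+1 / z i) ^+ 2 <=
      potential kappa (eta 0%N) (m * z 0%N) - potential kappa (eta k) (m * z k)]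
  /\ 0 < z k.
Proof.
have step i : (qn_state update f x0 B0 i).2^T = (qn_state update f x0 B0 i).2 ->
    m * z i <= 1 / 50 -> eta i + 2 * kappa * (m * z i) <= 15 / 56 -> _ :=
  fun Bs sg inv => quasi_newton_step df dg xs_min M_ge0 mu_gt0 H_ge hess_lip
    T_sym TTH kappa_ge0 update_bd update_congr update_sym
    (etrans (congr1 (qn_step update f) (esym (surjective_pairing _)))
       (surjective_pairing (qn_state update f x0 B0 i.+1)))
    Bs (nonterm i) sg inv.
elim: k => [|k [[Bs sg inv sum] _]].
  have h : eta 0%N + 2 * kappa * (m * z 0%N) <= 15 / 56.
    by move: kappa_sigma0_le tau0_le; lra.
  have [_ z0 _ _ _] := step 0%N B0_sym sigma0_le h.
  by split=> //; split=> //; rewrite big_ord0 subrr.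
have [Bs' z0 z'z inv' dec] := step k Bs sg inv.
have sg' : m * z k.+1 <= 1 / 50.
  by apply: le_trans sg; rewrite ler_wpM2l ?scaled_lip_ge0.
have [_ z'0 _ _ _] := step k.+1 Bs' sg' inv'.
split=> //; split=> //; rewrite big_ord_recr/=.
by apply: le_trans (lerD sum dec) _; rewrite addrA subrK.
Qed.

(** The initial potential is at most
    [9 / 49 + (135 / 14) / 16 + (2 / 25) / 50 < 1]. *)
Lemma dev_superlinear k : (0 < k)%N -> (z k / z 0%N) ^+ 2 <= (1 / k%:R) ^+ k.
Proof.
apply: (@prod_ratio_AGM R (fun i => z i) k) => [i|]; first by have [_] := qn_invariant i.
have [[_ _ _ sum] _] := qn_invariant k; apply: le_trans sum _.
have [[_ sgk _ _] zk] := qn_invariant k.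
have pk : 0 <= potential kappa (eta k) (m * z k).
  have sg0 : 0 <= m * z k by rewrite mulr_ge0 ?scaled_lip_ge0 ?fnorm_ge0.
  have := mulr_ge0 kappa_ge0 sg0; have := sqr_ge0 (eta k).
  rewrite /potential; lra.
apply: (@le_trans _ _ (potential kappa (eta 0%N) (m * z 0%N))).
  by rewrite lerBlDr lerDl.
have e0 : eta 0%N ^+ 2 <= (1 / 7) ^+ 2 by rewrite ler_pXn2r ?nnegrE ?fnorm_ge0.
rewrite /potential; move: kappa_sigma0_le sigma0_le; lra.
Qed.

(** With [sigma <= 1 / 50], the value [f x - f xs] lies between [12 / 25] and
    [13 / 25] times the squared deviation, and [13 / 12 <= 11 / 10]. *)
Lemma value_superlinear k : (0 < k)%N ->
  (f (qn_iterate update f x0 B0 k) - f xs) / (f x0 - f xs)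
    <= 11 / 10 * (1 / k%:R) ^+ k.
Proof.
move=> k0; set p := (1 / k%:R) ^+ k.
have p0 : 0 <= p by rewrite exprn_ge0// divr_ge0.
have [[_ sgk _ _] zk] := qn_invariant k; have [_ z0] := qn_invariant 0%N.
have value := value_near_quadratic df dg xs_min M_ge0 mu_gt0 H_ge hess_lip T_sym TTH.
have := value (qn_iterate update f x0 B0 k).
have := value (qn_iterate update f x0 B0 0%N).
rewrite !ler_norml => /andP[v0 _] /andP[_ vk].
have z02 : 0 < z 0%N ^+ 2 by rewrite exprn_gt0.
have sz0 : m * z 0%N * z 0%N ^+ 2 <= 1 / 50 * z 0%N ^+ 2 by rewrite ler_pM2r.
have szk : m * z k * z k ^+ 2 <= 1 / 50 * z k ^+ 2 by rewrite ler_wpM2r ?sqr_ge0.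
have zp : z k ^+ 2 <= p * z 0%N ^+ 2.
  by rewrite -ler_pdivrMr// -expr_div_n dev_superlinear.
have fx0 : 12 / 25 * z 0%N ^+ 2 <= f x0 - f xs.
  by move: v0 sz0; rewrite {2}/qn_iterate /qn_state /=; lra.
rewrite ler_pdivrMr; last by apply: lt_le_trans fx0; rewrite mulr_gt0//; lra.
have : p * (12 / 25 * z 0%N ^+ 2) <= p * (f x0 - f xs) by rewrite ler_wpM2l.
have : 0 <= p * z 0%N ^+ 2 by rewrite mulr_ge0// ltW.
lra.
Qed.

End Superlinear.

Theorem corollary4p8 (R : realType) (d : nat) (f : 'cV[R]_d -> R)
    (mu L M : R) (xs x0 : 'cV[R]_d) (B0 : 'M[R]_d)
    (mu_gt0 : 0 < mu) (L_gt0 : 0 < L) (M_ge0 : 0 <= M)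
    (f_diff2 : twice_differentiable f)
    (f_sconvex : strongly_convex mu f)
    (f_lip : forall x y, enorm (grad f x - grad f y) <= L * enorm (x - y))
    (xs_min : forall x, f xs <= f x)
    (hess_lip : forall x, opnorm (hess f x - hess f xs) <= M * enorm (x - xs))
    (B0_spd : sym_posdef B0) :
  let H := hess f xs in
  let Hsqrt := mxsqrt H in
  let Hisqrt := mxsqrt (invmx H) in
  let sigma0 := M / mu `^ (3 / 2) * enorm (Hsqrt *m (x0 - xs)) in
  let tau0 := frobenius_norm (Hisqrt *m (B0 - H) *m Hisqrt) in
  let superlinear (x : nat -> 'cV[R]_d) :=
    forall k : nat, (1 <= k)%N ->
      enorm (Hsqrt *m (x k - xs)) / enorm (Hsqrt *m (x0 - xs))
        <= (1 / k%:R) `^ (k%:R / 2) /\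
      (f (x k) - f xs) / (f x0 - f xs) <= 11 / 10 * (1 / k%:R) ^+ k in
  (qn_nonterminating (@dfp_update R d) f x0 B0 ->
   sigma0 <= 1 / 120 -> tau0 <= 1 / 7 ->
   superlinear (qn_iterate (@dfp_update R d) f x0 B0)) /\
  (qn_nonterminating (@bfgs_update R d) f x0 B0 ->
   sigma0 <= 1 / 50 -> tau0 <= 1 / 7 ->
   superlinear (qn_iterate (@bfgs_update R d) f x0 B0)).
Proof.
move=> H Hsqrt Hisqrt sigma0 tau0 superlinear.
have [df dg] := f_diff2; have [B0_sym _] := B0_spd.
have hl (x v : 'cV[R]_d) : fnorm ((hess f x - H) *m v) <= M * fnorm (x - xs) * fnorm v.
  apply: le_trans (le_opnorm _ _) _; rewrite ler_wpM2r ?fnorm_ge0//.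
  by rewrite -enormE.
have H_sym := hess_min_sym df dg xs_min M_ge0 hl.
have H_ge := hess_min_ge df dg xs_min M_ge0 f_sconvex hl.
have H_spd : sym_posdef H.
  split=> // v v0; rewrite dotvE; apply: lt_le_trans (H_ge v).
  by rewrite mulr_gt0// fdot_gt0.
have H_unit := sym_posdef_unit H_spd.
have [[Hsqrt_sym _] HsqrtE] := mxsqrtP H_spd.
have [[T_sym _] TE] := mxsqrtP (sym_posdef_inv H_spd).
rewrite -/Hisqrt in T_sym TE; rewrite -/Hsqrt in Hsqrt_sym HsqrtE.
have TTH : Hisqrt *m (Hisqrt *m H) = 1%:M by rewrite mulmxA TE mulVmx.
have devE x : enorm (Hsqrt *m (x - xs)) = fnorm (dev xs H Hisqrt x).
  rewrite enormE /fnorm; congr Num.sqrt.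
  rewrite /dev; set h := x - xs.
  have -> : fdot (Hsqrt *m h) (Hsqrt *m h) = fdot h (H *m h).
    by rewrite -fdot_sym// mulmxA HsqrtE.
  rewrite -mulmxA fdot_mulmxl T_sym !mulmxA -[_ *m _ *m H]mulmxA TTH mul1mx.
  by rewrite fdotC.
have lipE : M / mu `^ (3 / 2) = scaled_lip mu M by rewrite powR_three_halves.
have tauE : tau0 = fnorm (mxdev Hisqrt B0).
  rewrite /tau0 frobenius_normE mulmxBr mulmxBl; congr (fnorm (_ - _)).
  by apply: mulmx1C.
rewrite tauE {}/sigma0 lipE devE.
(* The constants of the statement satisfy [15 / 2 / 120 = 25 / 8 / 50 = 1 / 16]. *)
have main update kappa : 0 <= kappa -> bounded_deterioration update kappa ->
    congruence_equivariant update -> preserves_symmetry update ->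
    qn_nonterminating update f x0 B0 ->
    scaled_lip mu M * fnorm (dev xs H Hisqrt x0) <= 1 / 50 ->
    kappa * (scaled_lip mu M * fnorm (dev xs H Hisqrt x0)) <= 1 / 16 ->
    fnorm (mxdev Hisqrt B0) <= 1 / 7 ->
    superlinear (qn_iterate update f x0 B0).
  move=> kappa_ge0 bd congr sym nonterm sigma kappa_sigma tau k k1.
  have p0 : 0 <= 1 / k%:R :> R by rewrite divr_ge0.
  split.
    rewrite !devE powR_half_nat//.
    rewrite -[leLHS]ger0_norm ?divr_ge0 ?fnorm_ge0// -sqrtr_sqr ler_wsqrtr//.
    exact: (dev_superlinear df dg xs_min M_ge0 mu_gt0 H_ge hl T_sym TTH
      kappa_ge0 bd congr sym B0_sym nonterm sigma kappa_sigma tau).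
  exact: (value_superlinear df dg xs_min M_ge0 mu_gt0 H_ge hl T_sym TTH
    kappa_ge0 bd congr sym B0_sym nonterm sigma kappa_sigma tau).
split=> nonterm sigma tau.
  apply: (main _ (15 / 2) _ (@dfp_bounded_deterioration R d) (@dfp_congruence R d)
    (@dfp_preserves_symmetry R d)) => //; lra.
apply: (main _ (25 / 8) _ (@bfgs_bounded_deterioration R d) (@bfgs_congruence R d)
  (@bfgs_preserves_symmetry R d)) => //; lra.
Qed.
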